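(* Let $\Gamma$ be a split-by-nilpotent extension of $\Lambda$ by the two-sided ideal $I$ of $\Gamma$, with change of rings functors $F={}_\Lambda\Lambda_\Gamma\otimes_\Gamma-:\mathrm{mod}(\Gamma)\to\mathrm{mod}(\Lambda)$ and $G={}_\Gamma\Gamma_\Lambda\otimes_\Lambda-:\mathrm{mod}(\Lambda)\to\mathrm{mod}(\Gamma)$. Assume that the right $\Lambda$-module $I_\Lambda$ is projective. Let $(\Theta,\underline{Q},\leq)$ be an Ext-projective stratifying system of size $t$ in $\mathrm{mod}(\Lambda)$, with $Q:=\oplus_{i=1}^tQ(i)$ and $\mathbf{\Theta}:=\oplus_{i=1}^t\Theta(i)$, such that $\mathrm{Hom}_\Lambda(\mathbf{\Theta},I\otimes_\Lambda\mathbf{\Theta})=0=\mathrm{Ext}^1_\Lambda(Q,I\otimes_\Lambda\mathbf{\Theta})$. Then the following statements hold. (a) The stratifying system $(\Theta,\leq)$ is compatible with $I$, and $(G\Theta,G\underline{Q},\leq)$ is the Ext-projective stratifying system associated to $(G\Theta,\leq)$. (b) $G|_{\mathfrak{F}(\Theta)}:\mathfrak{F}(\Theta)\to\mathfrak{F}(G\Theta)$ is an exact equivalence of categories and $F|_{\mathfrak{F}(G\Theta)}:\mathfrak{F}(G\Theta)\to\mathfrak{F}(\Theta)$ is its quasi-inverse.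
   Context: Algebra means artin algebra over a commutative artinian ring $R$; $\mathrm{mod}(\Lambda)$ is the category of finitely generated left $\Lambda$-modules, and $[1,t]=\{1,\dots,t\}$. Given algebras $\Gamma,\Lambda$ and a two-sided ideal $I$ of $\Gamma$, $\Gamma$ is a split-by-nilpotent extension of $\Lambda$ by $I$ if $I\subseteq\mathrm{rad}(\Gamma)$ and there is an exact sequence of abelian groups $0\to I\to\Gamma\xrightarrow{\pi}\Lambda\to 0$ such that $\pi$ is an epimorphism of algebras and there is a morphism of algebras $\sigma:\Lambda\to\Gamma$ with $\pi\sigma=1_\Lambda$. Through $\sigma$ and $\pi$, $\Gamma$, $I$ and $\Lambda$ carry bimodule structures over $\Lambda$ and $\Gamma$. A stratifying system $(\Theta,\leq)$ of size $t$ in $\mathrm{mod}(\Lambda)$ consists of a family of indecomposable $\Lambda$-modules $\Theta=\{\Theta(i)\}_{i=1}^t$ and a linear order $\leq$ on $[1,t]$ such that $\mathrm{Hom}_\Lambda(\Theta(i),\Theta(j))=0$ if $i>j$ and $\mathrm{Ext}^1_\Lambda(\Theta(i),\Theta(j))=0$ if $i\geq j$ (inequalities refer to the given linear order). It is compatible with $I$ if $\mathrm{Hom}_\Lambda(\Theta(j),I\otimes_\Lambda\Theta(i))=0$ for $j>i$ and $\mathrm{Ext}^1_\Lambda(\Theta(j),I\otimes_\Lambda\Theta(i))=0$ for $j\geq i$. For a set $\Theta$ of $\Lambda$-modules, $\mathfrak{F}(\Theta)$ is the full subcategory of $\mathrm{mod}(\Lambda)$ of modules $M$ having a filtration $0=M_0\subseteq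 M_1\subseteq\cdots\subseteq M_s=M$ with each $M_{i+1}/M_i$ isomorphic to a module in $\Theta$. $G\Theta=\{G(\Theta(i))\}_{i=1}^t$ and $G\underline{Q}=\{G(Q(i))\}_{i=1}^t$. An Ext-projective stratifying system $(\Theta,\underline{Q},\leq)$ of size $t$ in $\mathrm{mod}(\Lambda)$ consists of two families of non-zero $\Lambda$-modules $\Theta=\{\Theta(i)\}_{i=1}^t$ and $\underline{Q}=\{Q(i)\}_{i=1}^t$ with all $Q(i)$ indecomposable, and a linear order $\leq$ on $[1,t]$, such that (a) $\mathrm{Hom}_\Lambda(\Theta(i),\Theta(j))=0$ if $i>j$; (b) for each $i$ there is an exact sequence $0\to K(i)\to Q(i)\to\Theta(i)\to 0$ with $K(i)\in\mathfrak{F}(\{\Theta(j):j>i\})$; (c) $\mathrm{Ext}^1_\Lambda(Q,\mathbf{\Theta})=0$. It is known that then $(\Theta,\leq)$ is a stratifying system, and that for each stratifying system $(\Theta,\leq)$ there is a unique (up to isomorphism) Ext-projective stratifying system $(\Theta,\underline{Q},\leq)$, called the one associated to $(\Theta,\leq)$. A functor between such subcategories is exact if it carries short exact sequences with all terms in the source subcategory to short exact sequences. *)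

(* Defs.v *)
From HB Require Import structures.
From mathcomp Require Import all_boot all_algebra.
From mathcomp Require Import boolp.
From mathcomp.multinomials Require Import freeg.

Set Implicit Arguments.
Unset Strict Implicit.
Unset Printing Implicit Defensive.

Import GRing.Theory.

Local Open Scope ring_scope.
Local Open Scope quotient_scope.

(* Left ideals of A are the submodules of A^o. R below is commutative, so the
   side plays no role there. *)
Definition artinian (A : nzRingType) : Prop :=
  forall J : nat -> submodClosed A^o,
    (forall n, {subset J n.+1 <= J n}) ->
    exists n, forall m, (n <= m)%N -> J m =i J n.

Definition maximal_left_ideal (A : nzRingType) (m : submodClosed A^o) : Prop :=
  1 \notin m /\
  forall J : submodClosed A^o, {subset m <= J} -> 1 \notin J -> J =i m.

Definition in_jacobson_radical (A : nzRingType) (x : A) : Prop :=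
  forall m : submodClosed A^o, maximal_left_ideal m -> x \in m.

Record ideal2 (A : nzRingType) := Ideal2 {
  ideal2_zmod :> zmodClosed A;
  ideal2Ml : forall a x : A, x \in ideal2_zmod -> a * x \in ideal2_zmod;
  ideal2Mr : forall x a : A, x \in ideal2_zmod -> x * a \in ideal2_zmod
}.

Definition fin_gen (A : pzRingType) (M : lmodType A) : Prop :=
  exists (n : nat) (e : 'I_n -> M),
    forall x, exists a : 'I_n -> A, x = \sum_(i < n) a i *: e i.

Definition artin_algebra (R : comNzRingType) (A : algType R) : Prop :=
  artinian R /\ fin_gen (A : lmodType R).

Record split_by_nilpotent (R : comNzRingType) (Gam Lam : algType R)
    (I : ideal2 Gam) (pi : {lrmorphism Gam -> Lam})
    (sigma : {lrmorphism Lam -> Gam}) : Prop := SplitByNilpotent {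
  split_rad : forall x, x \in I -> in_jacobson_radical x;
  split_ker : forall x, pi x = 0 <-> x \in I;
  split_surj : forall y, exists x, pi x = y;
  split_sec : cancel sigma pi
}.

Section Modules.
Variable A : pzRingType.
Implicit Types M N K P : lmodType A.

Definition zero_mod M : Prop := forall x : M, x = 0.

Definition iso_mod M N : Prop := exists f : {linear M -> N}, bijective f.

Definition indecomposable M : Prop :=
  ~ zero_mod M /\
  forall (X Y : lmodType A), iso_mod M (X * Y)%type -> zero_mod X \/ zero_mod Y.

Definition Hom_zero M N : Prop := forall (f : {linear M -> N}) x, f x = 0.

Definition short_exact K M N (f : {linear K -> M}) (g : {linear M -> N}) :=
  [/\ injective f,
      forall y, g y = 0 <-> exists x, f x = y
    & forall z, exists y, g y = z].

Definition projective P : Prop :=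
  forall M N (g : {linear M -> N}) (f : {linear P -> N}),
    (forall z, exists y, g y = z) ->
    exists h : {linear P -> M}, forall x, g (h x) = f x.

(* Ext^1(M, N) is the group of equivalence classes of the short exact
   sequences 0 -> N -> E -> M -> 0, its zero being the class of the direct
   sum. *)
Record extension M N := Extension {
  ext_mid : lmodType A;
  ext_in : {linear N -> ext_mid};
  ext_out : {linear ext_mid -> M};
  ext_exact : short_exact ext_in ext_out
}.

Definition ext_equiv M N (E E' : extension M N) : Prop :=
  exists f : {linear ext_mid E -> ext_mid E'},
    [/\ bijective f,
        forall x, f (ext_in E x) = ext_in E' x
      & forall y, ext_out E' (f y) = ext_out E y].

Section SplitExtension.
Variables M N : lmodType A.

Definition split_in (x : N) : N * M := (x, 0).

Lemma split_in_linear : linear split_in.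
Proof.
by move=> a x y; rewrite /split_in; congr pair => /=; rewrite scaler0 addr0.
Qed.

HB.instance Definition _ :=
  GRing.isLinear.Build A N (N * M)%type *:%R split_in split_in_linear.

Definition split_out : {linear (N * M)%type -> M} := snd.

Lemma split_exact : short_exact split_in split_out.
Proof.
split=> [x y [] // | [x y] /= | z]; last by exists (0, z).
by split=> [-> | [z [_ <-]] //]; exists x.
Qed.

Definition split_extension : extension M N := Extension split_exact.
End SplitExtension.

Definition Ext1_zero M N : Prop :=
  forall E : extension M N, ext_equiv E (split_extension M N).

End Modules.

Section DirectSum.
Variables (A : pzRingType) (J : finType) (M : J -> lmodType A).

Definition dirsum : Type := {dffun forall j, M j}.

HB.instance Definition _ := Choice.on dirsum.

Implicit Types x y : dirsum.

Definition ds_zero : dirsum := [ffun j => 0].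
Definition ds_opp x : dirsum := [ffun j => - x j].
Definition ds_add x y : dirsum := [ffun j => x j + y j].
Definition ds_scale (a : A) x : dirsum := [ffun j => a *: x j].

Lemma ds_addA : associative ds_add.
Proof. by move=> x y z; apply/ffunP=> j; rewrite !ffunE addrA. Qed.
Lemma ds_addC : commutative ds_add.
Proof. by move=> x y; apply/ffunP=> j; rewrite !ffunE addrC. Qed.
Lemma ds_add0 : left_id ds_zero ds_add.
Proof. by move=> x; apply/ffunP=> j; rewrite !ffunE add0r. Qed.
Lemma ds_addN : left_inverse ds_zero ds_opp ds_add.
Proof. by move=> x; apply/ffunP=> j; rewrite !ffunE addNr. Qed.

HB.instance Definition _ :=
  GRing.isZmodule.Build dirsum ds_addA ds_addC ds_add0 ds_addN.

Lemma ds_scaleA a b x : ds_scale a (ds_scale b x) = ds_scale (a * b) x.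
Proof. by apply/ffunP=> j; rewrite !ffunE scalerA. Qed.
Lemma ds_scale1 : left_id 1 ds_scale.
Proof. by move=> x; apply/ffunP=> j; rewrite !ffunE scale1r. Qed.
Lemma ds_scaleDr : right_distributive ds_scale +%R.
Proof. by move=> a x y; apply/ffunP=> j; rewrite !ffunE scalerDr. Qed.
Lemma ds_scaleDl x : {morph ds_scale^~ x : a b / a + b}.
Proof. by move=> a b; apply/ffunP=> j; rewrite !ffunE scalerDl. Qed.

HB.instance Definition _ := GRing.Zmodule_isLmodule.Build A dirsum
  ds_scaleA ds_scale1 ds_scaleDr ds_scaleDl.
End DirectSum.

Section Quotients.
Variables (A : pzRingType) (M : lmodType A).

Definition submod (N : submodClosed M) : Type := {x : M | x \in N}.

Section Sub.
Variable N : submodClosed M.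
HB.instance Definition _ := SubChoice.on (submod N).
HB.instance Definition _ := [SubChoice_isSubLmodule of submod N by <:].
End Sub.

Section Quot.
Variable N : submodClosed M.

Definition quot_pred : {pred M} := fun x => x \in N.

Lemma quot_pred_zmod : zmod_closed quot_pred.
Proof.
split=> [|x y Nx Ny]; rewrite unfold_in /quot_pred ?rpred0 //.
by rewrite rpredD // -scaleN1r rpredZ.
Qed.

HB.instance Definition _ := GRing.isZmodClosed.Build M quot_pred quot_pred_zmod.

Definition quotmod : Type := Quotient.quot quot_pred.

HB.instance Definition _ := GRing.Zmodule.on quotmod.

Definition quot_proj (x : M) : quotmod := \pi_(Quotient.quot quot_pred) x.
Definition quot_scale (a : A) (x : quotmod) : quotmod :=
  quot_proj (a *: repr (x : Quotient.quot quot_pred)).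

Lemma quot_projB : {morph quot_proj : x y / x - y}.
Proof. by move=> x y; rewrite /quot_proj; rewrite piE. Qed.

Lemma quot_projD : {morph quot_proj : x y / x + y}.
Proof. by move=> x y; rewrite /quot_proj; rewrite piE. Qed.

Lemma quot_proj_surj (x : quotmod) : exists y, quot_proj y = x.
Proof. by exists (repr (x : Quotient.quot quot_pred)); exact: reprK. Qed.

Lemma quot_proj_eq x y : (quot_proj x = quot_proj y) <-> (x - y \in N).
Proof.
have -> : (x - y \in N) = (x - y \in quot_pred) by [].
by rewrite Quotient.idealrBE; split=> /eqP.
Qed.

Lemma quot_scaleE a x : quot_scale a (quot_proj x) = quot_proj (a *: x).
Proof.
apply/quot_proj_eq; rewrite -scalerBr rpredZ //.
by apply/quot_proj_eq; exact: reprK.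
Qed.

Lemma quot_scaleA a b x : quot_scale a (quot_scale b x) = quot_scale (a * b) x.
Proof. by case: (quot_proj_surj x) => y <-; rewrite !quot_scaleE scalerA. Qed.
Lemma quot_scale1 : left_id 1 quot_scale.
Proof.
by move=> x; case: (quot_proj_surj x) => y <-; rewrite quot_scaleE scale1r.
Qed.
Lemma quot_scaleDr : right_distributive quot_scale +%R.
Proof.
move=> a x y; case: (quot_proj_surj x) (quot_proj_surj y) => x' <- [y' <-].
by rewrite -quot_projD !quot_scaleE scalerDr quot_projD.
Qed.
Lemma quot_scaleDl x : {morph quot_scale^~ x : a b / a + b}.
Proof.
move=> a b; case: (quot_proj_surj x) => y <-.
by rewrite !quot_scaleE scalerDl quot_projD.
Qed.

HB.instance Definition _ := GRing.Zmodule_isLmodule.Build A quotmod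
  quot_scaleA quot_scale1 quot_scaleDr quot_scaleDl.
End Quot.

End Quotients.

Section Subquotient.
Variables (A : pzRingType) (M : lmodType A).

(* N :&: N', as a submodule of N'. *)
Definition restr_pred (N N' : submodClosed M) : {pred submod N'} :=
  fun x => val x \in N.

Lemma restr_pred_submod N N' : subsemimod_closed (@restr_pred N N').
Proof.
have rE x : (x \in @restr_pred N N') = (val x \in N) by [].
split=> [|a x]; last by rewrite !rE linearZ => Nx; rewrite rpredZ.
split=> [|x y]; first by rewrite rE raddf0 rpred0.
by rewrite !rE raddfD => Nx Ny; rewrite rpredD.
Qed.

HB.instance Definition _ N N' := GRing.isSubmodClosed.Build
  A (submod N') (@restr_pred N N') (@restr_pred_submod N N').

(* The module N' / N, for N contained in N'. *)
Definition subquot (N N' : submodClosed M) : lmodType A :=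
  quotmod (@restr_pred N N').
End Subquotient.

(* M has a finite filtration with factors isomorphic to modules in S. *)
Definition filtered (A : pzRingType) (S : lmodType A -> Prop)
    (M : lmodType A) : Prop :=
  exists (s : nat) (F : nat -> submodClosed M),
    [/\ forall x, (x \in F 0%N) = (x == 0),
        forall x, x \in F s,
        forall i, (i < s)%N -> {subset F i <= F i.+1}
      & forall i, (i < s)%N ->
          exists2 X, S X & iso_mod (subquot (F i) (F i.+1)) X].

(* The objects of the full subcategory of mod(A) of the modules filtered by
   the X j such that P j. *)
Definition Filt (A : pzRingType) (J : Type) (P : J -> Prop)
    (X : J -> lmodType A) (M : lmodType A) : Prop :=
  fin_gen M /\ filtered (fun N => exists2 j, P j & N = X j) M.

Record bimod (A B : pzRingType) := Bimod {
  bimod_sort :> lmodType A;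
  ract : bimod_sort -> B -> bimod_sort;
  ractDl : forall x y b, ract (x + y) b = ract x b + ract y b;
  ractDr : forall x b c, ract x (b + c) = ract x b + ract x c;
  ractM : forall x b c, ract x (b * c) = ract (ract x b) c;
  ract1 : forall x, ract x 1 = x;
  ractZ : forall a x b, ract (a *: x) b = a *: ract x b
}.

(* The right module underlying X, as a left module over the converse ring. *)
Section RightModule.
Variables (A B : pzRingType) (X : bimod A B).

Definition rmod : Type := X.
HB.instance Definition _ := GRing.Zmodule.on rmod.

Definition rmod_scale (b : B^c) (x : rmod) : rmod := @ract A B X x b.

Lemma rmod_scaleA b c x : rmod_scale b (rmod_scale c x) = rmod_scale (b * c) x.
Proof. by rewrite /rmod_scale -ractM. Qed.
Lemma rmod_scale1 : left_id 1 rmod_scale.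
Proof. by move=> x; exact: ract1. Qed.
Lemma rmod_scaleDr : right_distributive rmod_scale +%R.
Proof. by move=> b x y; exact: ractDl. Qed.
Lemma rmod_scaleDl x : {morph rmod_scale^~ x : b c / b + c}.
Proof. by move=> b c; exact: ractDr. Qed.

HB.instance Definition _ := GRing.Zmodule_isLmodule.Build B^c rmod
  rmod_scaleA rmod_scale1 rmod_scaleDr rmod_scaleDl.
End RightModule.

Section Tensor.
Variables (A B : pzRingType) (X : bimod A B) (M : lmodType B).

Local Notation free := {freeg (X * M)%type / int}.
Local Notation gen x m := (<< (x, m) >> : free).

(* The subgroup generated by the relations defining the tensor product. *)
Inductive tens_rel : free -> Prop :=
| tens_rel0 : tens_rel 0
| tens_relB f g : tens_rel f -> tens_rel g -> tens_rel (f - g)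
| tens_relDl x y m : tens_rel (gen (x + y) m - gen x m - gen y m)
| tens_relDr x m n : tens_rel (gen x (m + n) - gen x m - gen x n)
| tens_rel_bal x b m : tens_rel (gen (ract x b) m - gen x (b *: m)).

Definition tens_pred : {pred free} := fun f => `[< tens_rel f >].

Lemma tens_pred_zmod : zmod_closed tens_pred.
Proof.
split=> [|f g /asboolP Nf /asboolP Ng]; apply/asboolP; first exact: tens_rel0.
exact: tens_relB.
Qed.

HB.instance Definition _ :=
  GRing.isZmodClosed.Build free tens_pred tens_pred_zmod.

Definition tensor : Type := Quotient.quot tens_pred.

HB.instance Definition _ := GRing.Zmodule.on tensor.

Definition tens_proj (f : free) : tensor := \pi_(Quotient.quot tens_pred) f.
Definition tens (x : X) (m : M) : tensor := tens_proj (gen x m).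

Lemma tens_proj_eq f g : tens_proj f = tens_proj g <-> tens_rel (f - g).
Proof.
split=> [/eqP|Nfg]; first by rewrite -Quotient.idealrBE => /asboolP.
by apply/eqP; rewrite -Quotient.idealrBE; apply/asboolP.
Qed.

Lemma tens_proj_is_zmod_morphism : zmod_morphism tens_proj.
Proof. by move=> f g; rewrite /tens_proj; rewrite piE. Qed.

HB.instance Definition _ := GRing.isZmodMorphism.Build free tensor tens_proj
  tens_proj_is_zmod_morphism.

Lemma tens_proj_surj (t : tensor) : exists f, tens_proj f = t.
Proof. by exists (repr (t : Quotient.quot tens_pred)); exact: reprK. Qed.

Lemma tensDl x y m : tens (x + y) m = tens x m + tens y m.
Proof.
apply/eqP; rewrite -subr_eq0 opprD addrA -!raddfB -(raddf0 tens_proj).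
by apply/eqP/tens_proj_eq; rewrite subr0; exact: tens_relDl.
Qed.

Lemma tensDr x m n : tens x (m + n) = tens x m + tens x n.
Proof.
apply/eqP; rewrite -subr_eq0 opprD addrA -!raddfB -(raddf0 tens_proj).
by apply/eqP/tens_proj_eq; rewrite subr0; exact: tens_relDr.
Qed.

Lemma tens_bal x b m : tens (ract x b) m = tens x (b *: m).
Proof. by apply/tens_proj_eq; exact: tens_rel_bal. Qed.

Section Lift.
Variables (Z : zmodType) (phi : X -> M -> Z).
Hypothesis phiDl : forall x y m, phi (x + y) m = phi x m + phi y m.
Hypothesis phiDr : forall x m n, phi x (m + n) = phi x m + phi x n.
Hypothesis phi_bal : forall x b m, phi (ract x b) m = phi x (b *: m).

Definition free_lift : free -> Z :=
  fglift (fun k : (X * M)%type => phi k.1 k.2 : ssrint.zmodule Z).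

Lemma free_liftB : {morph free_lift : f g / f - g}.
Proof. exact: (@lift_is_additive int _ (ssrint.zmodule Z)). Qed.

Lemma free_lift_gen x m : free_lift (gen x m) = phi x m.
Proof. by rewrite /free_lift liftU scale1r. Qed.

Lemma free_lift_rel f : tens_rel f -> free_lift f = 0.
Proof.
elim=> [|{}f g _ f0 _ g0|x y m|x m n|x b m]; rewrite ?free_liftB.
- by have := free_liftB 0 0; rewrite !subrr.
- by rewrite f0 g0 subrr.
- by rewrite !free_lift_gen phiDl -addrA -opprD subrr.
- by rewrite !free_lift_gen phiDr -addrA -opprD subrr.
- by rewrite !free_lift_gen phi_bal subrr.
Qed.

Definition tens_lift (t : tensor) : Z :=
  free_lift (repr (t : Quotient.quot tens_pred)).

Lemma tens_lift_proj f : tens_lift (tens_proj f) = free_lift f.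
Proof.
apply/eqP; rewrite -subr_eq0 -free_liftB; apply/eqP/free_lift_rel.
by apply/tens_proj_eq; exact: reprK.
Qed.

Lemma tens_liftE x m : tens_lift (tens x m) = phi x m.
Proof. by rewrite tens_lift_proj free_lift_gen. Qed.

Lemma tens_liftB : {morph tens_lift : s t / s - t}.
Proof.
move=> s t; case: (tens_proj_surj s) (tens_proj_surj t) => f <- [g <-].
by rewrite -raddfB !tens_lift_proj free_liftB.
Qed.
End Lift.

Lemma tens_ind (P : tensor -> Prop) :
  P 0 -> (forall s t, P s -> P t -> P (s - t)) ->
  (forall x m, P (tens x m)) -> forall t, P t.
Proof.
move=> P0 PB Pg t; case: (tens_proj_surj t) => f <-.
have PN s : P s -> P (- s) by move=> Ps; rewrite -sub0r; apply: PB.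
have PD s u : P s -> P u -> P (s + u).
  by move=> Ps Pu; rewrite -[u]opprK; apply: PB => //; apply: PN.
rewrite -[f]freeg_sumE raddf_sum; elim/big_ind: _ => // k _.
rewrite -[coeff k f]intz -freegU_mulz.
have Pk : P (tens_proj << k >>) by case: k => x m; exact: Pg.
case: (coeff k f) => n; rewrite ?NegzE ?mulrNz ?raddfN -?pmulrn raddfMn.
  by elim: n => [|n IHn]; rewrite ?mulr0n // mulrS; apply: PD.
by apply: PN; elim: n => [|n IHn]; rewrite ?mulr1n // mulrS; apply: PD.
Qed.

Lemma tens_ext (Z : zmodType) (f g : tensor -> Z) :
  {morph f : s t / s - t} -> {morph g : s t / s - t} ->
  (forall x m, f (tens x m) = g (tens x m)) -> f =1 g.
Proof.
move=> fB gB fg; apply: tens_ind => // [|s t IHs IHt].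
  by have := fB 0 0; have := gB 0 0; rewrite !subrr => -> ->.
by rewrite fB gB IHs IHt.
Qed.

Definition tens_scale (a : A) : tensor -> tensor :=
  tens_lift (fun x m => tens (a *: x) m).

Section Scale.
Variable a : A.
Let phi (x : X) (m : M) := tens (a *: x) m.
Let phiDl x y m : phi (x + y) m = phi x m + phi y m.
Proof. by rewrite /phi scalerDr tensDl. Qed.
Let phiDr x m n : phi x (m + n) = phi x m + phi x n.
Proof. exact: tensDr. Qed.
Let phi_bal x b m : phi (ract x b) m = phi x (b *: m).
Proof. by rewrite /phi -ractZ tens_bal. Qed.

Lemma tens_scaleE x m : tens_scale a (tens x m) = tens (a *: x) m.
Proof. exact: (tens_liftE phiDl phiDr phi_bal). Qed.

Lemma tens_scaleB : {morph tens_scale a : s t / s - t}.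
Proof. exact: (tens_liftB phiDl phiDr phi_bal). Qed.

Lemma tens_scaleDr : {morph tens_scale a : s t / s + t}.
Proof.
move=> s t; rewrite -[t in LHS]opprK tens_scaleB.
by rewrite -[- t]sub0r tens_scaleB -{1}(subrr t) tens_scaleB subrr sub0r opprK.
Qed.
End Scale.

Lemma tens_scaleA a b t : tens_scale a (tens_scale b t) = tens_scale (a * b) t.
Proof.
move: t; apply: tens_ext => [s t|s t|x m]; rewrite ?tens_scaleB //.
by rewrite !tens_scaleE scalerA.
Qed.

Lemma tens_scale1 : left_id 1 tens_scale.
Proof.
apply: tens_ext => [s t|s t|x m] //; rewrite ?tens_scaleB //.
by rewrite tens_scaleE scale1r.
Qed.

Lemma tens_scaleDl t : {morph tens_scale^~ t : a b / a + b}.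
Proof.
move=> a b; move: t; apply: tens_ext => [s t|s t|x m].
- by rewrite tens_scaleB.
- by rewrite !tens_scaleB opprD addrACA.
by rewrite !tens_scaleE scalerDl tensDl.
Qed.

HB.instance Definition _ := GRing.Zmodule_isLmodule.Build A tensor
  tens_scaleA tens_scale1 tens_scaleDr tens_scaleDl.

End Tensor.

Section TensorMap.
Variables (A B : pzRingType) (X : bimod A B) (M N : lmodType B).
Variable f : {linear M -> N}.

Definition tens_map : tensor X M -> tensor X N :=
  tens_lift (fun x m => tens x (f m)).

Let phi (x : X) (m : M) := tens x (f m).
Let phiDl x y m : phi (x + y) m = phi x m + phi y m.
Proof. exact: tensDl. Qed.
Let phiDr x m n : phi x (m + n) = phi x m + phi x n.
Proof. by rewrite /phi raddfD tensDr. Qed.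
Let phi_bal x b m : phi (ract x b) m = phi x (b *: m).
Proof. by rewrite /phi linearZ tens_bal. Qed.

Lemma tens_mapE x m : tens_map (tens x m) = tens x (f m).
Proof. exact: (tens_liftE phiDl phiDr phi_bal). Qed.

Lemma tens_map_is_zmod_morphism : zmod_morphism tens_map.
Proof. exact: (tens_liftB phiDl phiDr phi_bal). Qed.

HB.instance Definition _ := GRing.isZmodMorphism.Build (tensor X M) (tensor X N)
  tens_map tens_map_is_zmod_morphism.

Lemma tens_map_scalable : scalable tens_map.
Proof.
move=> a; apply: tens_ext => [s t|s t|x m].
- by rewrite scalerBr raddfB.
- by rewrite raddfB scalerBr.
have sE (L : lmodType B) y (n : L) : a *: tens y n = tens (a *: y) n :> tensor X L.
  exact: tens_scaleE.
by rewrite tens_mapE !sE tens_mapE.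
Qed.

HB.instance Definition _ := GRing.isScalable.Build A (tensor X M) (tensor X N)
  *:%R tens_map tens_map_scalable.
End TensorMap.

Record functor (A B : pzRingType) := Functor {
  fobj :> lmodType A -> lmodType B;
  fmap : forall M N : lmodType A, {linear M -> N} -> {linear fobj M -> fobj N};
  fmap_ext : forall (M N : lmodType A) (f g : {linear M -> N}), f =1 g -> fmap f =1 fmap g;
  fmap_id : forall M : lmodType A, fmap (idfun : {linear M -> M}) =1 id;
  fmap_comp : forall (M N P : lmodType A)
      (g : {linear N -> P}) (f : {linear M -> N}),
    fmap (g \o f : {linear M -> P}) =1 fmap g \o fmap f
}.

Section TensorFunctor.
Variables (A B : pzRingType) (X : bimod A B).

Definition tfun_obj (M : lmodType B) : lmodType A := tensor X M.
Definition tfun_map (M N : lmodType B) (f : {linear M -> N}) :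
  {linear tfun_obj M -> tfun_obj N} := @tens_map A B X M N f.

Implicit Types M N P : lmodType B.

Lemma tfun_ext M N (f g : {linear M -> N}) :
  f =1 g -> tfun_map f =1 tfun_map g.
Proof.
move=> fg; apply: tens_ext => [s t|s t|x m]; rewrite ?raddfB //.
by rewrite /= !tens_mapE fg.
Qed.

Lemma tfun_id M : tfun_map (idfun : {linear M -> M}) =1 id.
Proof.
apply: tens_ext => [s t|s t|x m]; rewrite ?raddfB //.
by rewrite /= tens_mapE.
Qed.

Lemma tfun_comp M N P (g : {linear N -> P}) (f : {linear M -> N}) :
  tfun_map (g \o f : {linear M -> P}) =1 tfun_map g \o tfun_map f.
Proof.
apply: tens_ext => [s t|s t|x m]; rewrite ?raddfB //.
by rewrite /= !tens_mapE.
Qed.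

Definition tensor_functor : functor B A := Functor tfun_ext tfun_id tfun_comp.
End TensorFunctor.

(* Predicates on objects stand for full subcategories. *)
Section FunctorNotions.
Variables A B : pzRingType.

Definition sends (P : lmodType A -> Prop) (Q : lmodType B -> Prop)
  (S : functor A B) : Prop := forall M, P M -> Q (S M).

Definition exact_on (P : lmodType A -> Prop) (S : functor A B) : Prop :=
  forall (K M N : lmodType A) (f : {linear K -> M}) (g : {linear M -> N}),
    P K -> P M -> P N -> short_exact f g -> short_exact (fmap S f) (fmap S g).

(* T o S, restricted to P, is naturally isomorphic to the identity. *)
Definition comp_iso_id (P : lmodType A -> Prop)
    (S : functor A B) (T : functor B A) : Prop :=
  exists eta : forall M, P M -> {linear T (S M) -> M},
    (forall M (pM : P M), bijective (eta M pM)) /\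
    (forall (M N : lmodType A) (pM : P M) (pN : P N) (f : {linear M -> N}) x,
       eta N pN (fmap T (fmap S f) x) = f (eta M pM x)).
End FunctorNotions.

Definition equivalence_with_quasi_inverse (A B : pzRingType)
    (P : lmodType A -> Prop) (Q : lmodType B -> Prop)
    (S : functor A B) (T : functor B A) : Prop :=
  [/\ sends P Q S, sends Q P T, comp_iso_id P S T & comp_iso_id Q T S].

(* C as an (A, B)-bimodule through f : A -> C and g : B -> C. *)
Section RingBimodule.
Variables (A B C : pzRingType) (f : {rmorphism A -> C}) (g : {rmorphism B -> C}).

Definition res_ring (f : A -> C) : Type := C.
HB.instance Definition _ := GRing.Zmodule.on (res_ring f).

Definition res_scale (a : A) (x : res_ring f) : res_ring f := f a * (x : C).

Lemma res_scaleA a b x : res_scale a (res_scale b x) = res_scale (a * b) x.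
Proof. by rewrite /res_scale rmorphM mulrA. Qed.
Lemma res_scale1 : left_id 1 res_scale.
Proof. by move=> x; rewrite /res_scale rmorph1 mul1r. Qed.
Lemma res_scaleDr : right_distributive res_scale +%R.
Proof. by move=> a x y; exact: mulrDr. Qed.
Lemma res_scaleDl x : {morph res_scale^~ x : a b / a + b}.
Proof. by move=> a b; rewrite /res_scale rmorphD mulrDl. Qed.

HB.instance Definition _ := GRing.Zmodule_isLmodule.Build A (res_ring f)
  res_scaleA res_scale1 res_scaleDr res_scaleDl.

Definition res_ract (x : res_ring f) (b : B) : res_ring f := (x : C) * g b.

Lemma res_ractDl x y b : res_ract (x + y) b = res_ract x b + res_ract y b.
Proof. exact: mulrDl. Qed.
Lemma res_ractDr x b c : res_ract x (b + c) = res_ract x b + res_ract x c.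
Proof. by rewrite /res_ract rmorphD mulrDr. Qed.
Lemma res_ractM x b c : res_ract x (b * c) = res_ract (res_ract x b) c.
Proof. by rewrite /res_ract rmorphM mulrA. Qed.
Lemma res_ract1 x : res_ract x 1 = x.
Proof. by rewrite /res_ract rmorph1 mulr1. Qed.
Lemma res_ractZ a x b : res_ract (a *: x) b = a *: res_ract x b.
Proof. by rewrite /res_ract -mulrA. Qed.

Definition ring_bimod : bimod A B :=
  Bimod res_ractDl res_ractDr res_ractM res_ract1 res_ractZ.
End RingBimodule.

(* The two-sided ideal I of C as an (A, A)-bimodule through f : A -> C. *)
Section IdealBimodule.
Variables (A : pzRingType) (C : nzRingType) (f : {rmorphism A -> C}).
Variable I : ideal2 C.

Definition res_ideal (f : A -> C) (I : ideal2 C) : Type := {x : C | x \in I}.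

HB.instance Definition _ := SubChoice.on (res_ideal f I).
HB.instance Definition _ := [SubChoice_isSubZmodule of res_ideal f I by <:].

Definition ideal_scale (a : A) (x : res_ideal f I) : res_ideal f I :=
  exist _ (f a * val x) (ideal2Ml (f a) (valP x)).

Definition ideal_ract (x : res_ideal f I) (a : A) : res_ideal f I :=
  exist _ (val x * f a) (ideal2Mr (f a) (valP x)).

Lemma ideal_scaleA a b x :
  ideal_scale a (ideal_scale b x) = ideal_scale (a * b) x.
Proof. by apply/val_inj; rewrite /= rmorphM mulrA. Qed.
Lemma ideal_scale1 : left_id 1 ideal_scale.
Proof. by move=> x; apply/val_inj; rewrite /= rmorph1 mul1r. Qed.
Lemma ideal_scaleDr : right_distributive ideal_scale +%R.
Proof. by move=> a x y; apply/val_inj; exact: mulrDr. Qed.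
Lemma ideal_scaleDl x : {morph ideal_scale^~ x : a b / a + b}.
Proof. by move=> a b; apply/val_inj; rewrite /= rmorphD mulrDl. Qed.

HB.instance Definition _ := GRing.Zmodule_isLmodule.Build A (res_ideal f I)
  ideal_scaleA ideal_scale1 ideal_scaleDr ideal_scaleDl.

Lemma ideal_ractDl x y a : ideal_ract (x + y) a = ideal_ract x a + ideal_ract y a.
Proof. by apply/val_inj; exact: mulrDl. Qed.
Lemma ideal_ractDr x a b : ideal_ract x (a + b) = ideal_ract x a + ideal_ract x b.
Proof. by apply/val_inj; rewrite /= rmorphD mulrDr. Qed.
Lemma ideal_ractM x a b : ideal_ract x (a * b) = ideal_ract (ideal_ract x a) b.
Proof. by apply/val_inj; rewrite /= rmorphM mulrA. Qed.
Lemma ideal_ract1 x : ideal_ract x 1 = x.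
Proof. by apply/val_inj; rewrite /= rmorph1 mulr1. Qed.
Lemma ideal_ractZ a x b : ideal_ract (a *: x) b = a *: ideal_ract x b.
Proof. by apply/val_inj; rewrite /= mulrA. Qed.

Definition ideal_bimod : bimod A A :=
  Bimod ideal_ractDl ideal_ractDr ideal_ractM ideal_ract1 ideal_ractZ.
End IdealBimodule.

Section ChangeOfRings.
Variables (R : comNzRingType) (Gam Lam : algType R).
Variables (pi : {lrmorphism Gam -> Lam}) (sigma : {lrmorphism Lam -> Gam}).

Definition functorF : functor Gam Lam :=
  tensor_functor (ring_bimod (idfun : {rmorphism Lam -> Lam}) pi).

Definition functorG : functor Lam Gam :=
  tensor_functor (ring_bimod (idfun : {rmorphism Gam -> Gam}) sigma).
End ChangeOfRings.

(* Families are indexed by 'I_t, standing for [1,t]. *)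
Definition linear_order (t : nat) (le : rel 'I_t) : Prop :=
  [/\ reflexive le, antisymmetric le, transitive le & total le].

Definition strict (t : nat) (le : rel 'I_t) : rel 'I_t :=
  fun i j => (i != j) && le i j.

Section StratifyingSystems.
Variables (A : pzRingType) (t : nat).

Definition stratifying_system (Theta : 'I_t -> lmodType A) (le : rel 'I_t)
    : Prop :=
  [/\ linear_order le,
      forall i, fin_gen (Theta i) /\ indecomposable (Theta i),
      forall i j, strict le j i -> Hom_zero (Theta i) (Theta j)
    & forall i j, le j i -> Ext1_zero (Theta i) (Theta j)].

Definition compatible (X : bimod A A) (Theta : 'I_t -> lmodType A)
    (le : rel 'I_t) : Prop :=
  (forall i j, strict le i j -> Hom_zero (Theta j) (tensor X (Theta i))) /\
  (forall i j, le i j -> Ext1_zero (Theta j) (tensor X (Theta i))).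

Definition ext_projective_system (Theta Q : 'I_t -> lmodType A)
    (le : rel 'I_t) : Prop :=
  [/\ linear_order le,
      forall i, fin_gen (Theta i) /\ ~ zero_mod (Theta i),
      forall i, fin_gen (Q i) /\ indecomposable (Q i),
      forall i j, strict le j i -> Hom_zero (Theta i) (Theta j)
    & (forall i, exists (K : lmodType A) (f : {linear K -> Q i})
          (g : {linear Q i -> Theta i}),
         Filt (fun j => strict le i j) Theta K /\ short_exact f g) /\
      Ext1_zero (dirsum Q) (dirsum Theta)].

(* Ext-projective systems with a given (Theta, le) are unique up to
   isomorphism, so being "the associated" one is being one. *)
Definition associated_ext_projective_system (Theta Q : 'I_t -> lmodType A)
    (le : rel 'I_t) : Prop :=
  stratifying_system Theta le /\ ext_projective_system Theta Q le.

End StratifyingSystems.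

(* Main.v *)
(* Since I_Lam is projective, G is exact and the restriction of G(M) to Lam
   splits as M (+) (I (x) M).  By the adjunction between G and restriction,
   Hom and Ext^1 from G(M) to G(M') are those from M to M (+) (I (x) M'), and
   the I (x) M' parts vanish on the modules filtered by Theta, because K(i) and
   the resolution 0 -> K(i) -> Q(i) -> Theta(i) -> 0 transport the hypotheses on
   Q to Theta.  Hence G preserves the Ext-projective system, is full on
   F(Theta), and every extension of modules of G(F(Theta)) comes from Lam.
   Indecomposability of Theta(i) comes from lifting idempotents to Q(i) and
   Fitting's lemma, that of G(Q(i)) from F G = id and Nakayama's lemma. *)
From HB Require Import structures.
Require Import Defs.
From mathcomp Require Import all_boot all_algebra.
From mathcomp Require Import boolp.
From mathcomp Require classical_sets.

Set Implicit Arguments.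
Unset Strict Implicit.
Unset Printing Implicit Defensive.

Import GRing.Theory.

Local Open Scope ring_scope.

(** * Linear maps, submodules and quotients *)

Section LinearMaps.
Variable A : pzRingType.
Implicit Types K M N P : lmodType A.

(** Ext^1 is handled as classes of extensions, without long exact sequences: the segments that
    matter become lifting statements proved by diagram chases, and passing to direct summands
    becomes passing to retracts. Exactness of tensoring has an equally elementary source. [Gam] is
    finitely generated over [R], hence [I] is finitely generated on the right over [Lam];
    projectivity then yields a finite dual basis, and tensors acquire coordinates in which exactness
    can be checked. The obstacle in Fitting's lemma is that [R] artinian directly gives only the
    descending chain condition. It stabilises the images of the powers of an endomorphism;
    injectivity on the stable image is then drawn from Cayley-Hamilton rather than from an ascending
    chain of kernels. *)

Definition mklin M N (f : M -> N) (f_lin : linear f) : {linear M -> N} :=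
  HB.pack f (GRing.isLinear.Build A M N *:%R f f_lin).

Lemma linear_inj M N (f : {linear M -> N}) :
  (forall x, f x = 0 -> x = 0) -> injective f.
Proof.
move=> f0 x y fxy; apply/eqP; rewrite -subr_eq0; apply/eqP/f0.
by rewrite linearB fxy subrr.
Qed.

(** Any set-theoretic section of [b] will do: [c] does not see the choice of preimages, and this
    makes the factor linear. *)
Lemma comp_surj_ker M N P (b : {linear M -> N}) (c : {linear M -> P}) :
  (forall z, exists y, b y = z) -> (forall y, b y = 0 -> c y = 0) ->
  exists d : {linear N -> P}, forall y, d (b y) = c y.
Proof.
move=> b_surj bc0.
pose s z := sval (cid (b_surj z)).
have sK z : b (s z) = z by exact: (svalP (cid (b_surj z))).
have csb y : c (s (b y)) = c y.
  by apply/eqP; rewrite -subr_eq0 -linearB bc0 // linearB sK subrr.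
have d_lin : linear (fun z => c (s z)).
  by move=> a z z'; rewrite -(sK z) -(sK z') -linearP !csb linearP.
by exists (mklin d_lin) => y; exact: csb.
Qed.

Lemma lift_inj M N P (a : {linear M -> N}) (c : {linear P -> N}) :
  injective a -> (forall p, exists x, a x = c p) ->
  exists d : {linear P -> M}, forall p, a (d p) = c p.
Proof.
move=> a_inj ca.
pose d p := sval (cid (ca p)).
have dE p : a (d p) = c p by exact: (svalP (cid (ca p))).
have d_lin : linear d by move=> k p p'; apply: a_inj; rewrite linearP !dE linearP.
by exists (mklin d_lin).
Qed.

Lemma bijective_inj_surj M N (f : {linear M -> N}) :
  injective f -> (forall z, exists y, f y = z) -> bijective f.
Proof.
move=> f_inj f_surj; exists (fun z => sval (cid (f_surj z))) => [x|z].
  by apply: f_inj; exact: (svalP (cid (f_surj (f x)))).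
exact: (svalP (cid (f_surj z))).
Qed.

Lemma bij_surj M N (f : M -> N) : bijective f -> forall z, exists y, f y = z.
Proof. by case=> g _ fK z; exists (g z). Qed.

Lemma bij_inv M N (f : {linear M -> N}) : bijective f ->
  exists g : {linear N -> M}, cancel f g /\ cancel g f.
Proof.
move=> f_bij; have f_inj := bij_inj f_bij.
have [g gE] := lift_inj (c := idfun) f_inj (bij_surj f_bij).
by exists g; split=> [x|//]; apply: f_inj; exact: gE.
Qed.

Lemma iter_linear M (f : {linear M -> M}) n : linear (iter n f).
Proof. by elim: n => // n IHn a x y; rewrite !iterS IHn linearP. Qed.

Lemma iso_mod_refl M : iso_mod M M.
Proof. by exists idfun; exists idfun. Qed.

Lemma iso_mod_sym M N : iso_mod M N -> iso_mod N M.
Proof. by case=> f /bij_inv[g [fK gK]]; exists g; exists f. Qed.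

Lemma iso_mod_trans M N P : iso_mod M N -> iso_mod N P -> iso_mod M P.
Proof. by move=> [f fb] [g gb]; exists (g \o f); exact: bij_comp. Qed.

Lemma iso_zero_mod M N : iso_mod M N -> zero_mod M -> zero_mod N.
Proof. by move=> [f /bij_surj fs] M0 z; have [x <-] := fs z; rewrite (M0 x) linear0. Qed.

Lemma short_exact_isol K K' M N (u : {linear K' -> K}) (f : {linear K -> M})
    (g : {linear M -> N}) :
  bijective u -> short_exact f g -> short_exact (f \o u : {linear K' -> M}) g.
Proof.
move=> u_bij [f_inj fg g_surj]; split=> // [|y].
  exact: inj_comp f_inj (bij_inj u_bij).
rewrite fg; split=> [[x <-]|[x <-]]; last by exists (u x).
by have [z <-] := bij_surj u_bij x; exists z.
Qed.

Lemma short_exact_isor K M N N' (f : {linear K -> M}) (g : {linear M -> N})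
    (u : {linear N -> N'}) :
  bijective u -> short_exact f g -> short_exact f (u \o g : {linear M -> N'}).
Proof.
move=> u_bij [f_inj fg g_surj]; split=> // [y|z].
  rewrite -fg; split=> /= [|->]; last exact: linear0.
  by move=> ugy; apply: (bij_inj u_bij); rewrite ugy linear0.
by have [y <-] := bij_surj u_bij z; have [x <-] := g_surj y; exists x.
Qed.

(* Membership in a [submodClosed] is a boolean, hence the detour by [asbool]. *)
Definition is_submod M (P : M -> Prop) : Prop :=
  P 0 /\ forall a x y, P x -> P y -> P (a *: x + y).

Lemma is_submod_closed M (P : M -> Prop) :
  is_submod P -> GRing.subsemimod_closed (fun x => `[< P x >]).
Proof.
case=> P0 PD; split; first split; first exact/asboolP.
  move=> x y /asboolP Px /asboolP Py; apply/asboolP.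
  by rewrite -[x]scale1r; exact: PD.
move=> a x /asboolP Px; apply/asboolP.
by rewrite -[_ *: _]addr0; exact: PD.
Qed.

Definition subm M (P : M -> Prop) (HP : is_submod P) : submodClosed M :=
  HB.pack (fun x => `[< P x >])
    (GRing.isSubmodClosed.Build A M _ (is_submod_closed HP)).

Lemma submE M (P : M -> Prop) (HP : is_submod P) x : (x \in subm HP) <-> P x.
Proof. by split=> [/asboolP|?]; last exact/asboolP. Qed.

Definition subm_in M (P : M -> Prop) (HP : is_submod P) x (Px : P x) :
  submod (subm HP) := exist _ x ((submE HP x).2 Px).

Lemma is_submodB M (P : M -> Prop) : is_submod P -> forall x y, P x -> P y -> P (x - y).
Proof. by move=> [_ PD] x y Px Py; rewrite addrC -scaleN1r; exact: PD. Qed.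

Lemma is_submodD M (P : M -> Prop) : is_submod P -> forall x y, P x -> P y -> P (x + y).
Proof. by move=> [_ PD] x y Px Py; rewrite -[x]scale1r; exact: PD. Qed.

Lemma is_submod_mem M (N : submodClosed M) : is_submod (fun x => x \in N).
Proof.
split=> [|a x y Nx Ny]; first exact: rpred0.
by rewrite rpredD // rpredZ.
Qed.

Lemma is_submod_im M N (f : {linear M -> N}) : is_submod (fun y => exists x, f x = y).
Proof.
split=> [|a _ _ [x <-] [y <-]]; first by exists 0; rewrite linear0.
by exists (a *: x + y); rewrite linearP.
Qed.

Lemma is_submod_ker M N (f : {linear M -> N}) : is_submod (fun x => f x = 0).
Proof.
split=> [|a x y fx fy]; first exact: linear0.
by rewrite linearP fx fy scaler0 addr0.
Qed.

Lemma quot_proj_linear M (N : submodClosed M) : linear (@quot_proj A M N).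
Proof. by move=> a x y; rewrite quot_projD -quot_scaleE. Qed.

Definition quot_lin M (N : submodClosed M) : {linear M -> quotmod N} :=
  mklin (@quot_proj_linear M N).

Lemma quot_lin_surj M (N : submodClosed M) z : exists y, @quot_lin M N y = z.
Proof. exact: quot_proj_surj. Qed.

Lemma quot_lin_eq0 M (N : submodClosed M) x : (@quot_lin M N x = 0) <-> x \in N.
Proof. by rewrite -(linear0 (@quot_lin M N)) quot_proj_eq subr0. Qed.

Definition val_lin M (N : submodClosed M) : {linear submod N -> M} := val.

Lemma quot_iso M N (X : submodClosed M) (g : {linear M -> N}) :
  (forall z, exists y, g y = z) -> (forall x, (x \in X) <-> g x = 0) ->
  iso_mod (quotmod X) N.
Proof.
move=> g_surj Xg.
have [d dE] : exists d : {linear quotmod X -> N}, forall y, d (quot_lin X y) = g y.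
  apply: comp_surj_ker => [z|y]; first exact: quot_lin_surj.
  by rewrite quot_lin_eq0 Xg.
exists d; apply: bijective_inj_surj => [|z].
  apply: linear_inj => z; have [y <-] := quot_lin_surj z.
  by move=> dy0; apply/quot_lin_eq0/Xg; rewrite -dE.
by have [y <-] := g_surj z; exists (quot_lin X y).
Qed.

Lemma subquot_iso M K (N N' : submodClosed M) (g : {linear submod N' -> K}) :
  (forall z, exists y, g y = z) -> (forall x, (val x \in N) <-> g x = 0) ->
  iso_mod (subquot N N') K.
Proof. by move=> g_surj Ng; apply: quot_iso g_surj _ => x; exact: Ng. Qed.

End LinearMaps.

(** * Vanishing of Ext^1 and Hom along exact sequences, and filtrations *)

Section ExtLifting.
Variable A : pzRingType.
Implicit Types K M N P E : lmodType A.

(* [Ext1_zero M N] as a lifting property; as [M'] need not be [M], the pullback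
   of an extension along [f] is built in. *)
Definition lifts M N : Prop :=
  forall E M' (i : {linear N -> E}) (g : {linear E -> M'}) (f : {linear M -> M'}),
    short_exact i g -> exists h : {linear M -> E}, forall x, g (h x) = f x.

(** The fibre product of [E] and [M] over [M'] is an extension of [M] by [N]. It splits, and the
    [E]-component of the splitting is the lift. *)
Lemma Ext1_zero_lifts M N : Ext1_zero M N -> lifts M N.
Proof.
move=> ext0 E M' i g f [i_inj ig g_surj].
pose P (z : (E * M)%type) := g z.1 = f z.2.
have Psub : is_submod P.
  split=> [|a x y Px Py]; first by rewrite /P /= !linear0.
  by rewrite /P /= !linearP Px Py.
pose PB := submod (subm Psub).
have PBP (z : PB) : g (val z).1 = f (val z).2 by exact: ((submE Psub (val z)).1 (valP z)).
have P0 x : P (i x, 0) by rewrite /P linear0; apply/ig; exists x.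
pose in0 x : PB := subm_in Psub (P0 x).
have in_lin : linear in0.
  move=> a x y; apply: val_inj; rewrite /= linearP; congr pair.
  by rewrite /= scaler0 addr0.
have out_lin : linear (fun z : PB => (val z).2) by [].
have ex : short_exact (mklin in_lin) (mklin out_lin).
  split=> [x y /(congr1 val)[] /i_inj //|z|m].
    split=> /= [z0|[x <-] //].
    have /ig[x ix] : g (val z).1 = 0 by rewrite PBP z0 linear0.
    exists x; apply: val_inj; move: z0 ix => /=.
    by case: (val z) => y m /= -> ->.
  have [y gy] := g_surj (f m).
  by exists (subm_in Psub (gy : P (y, m))).
have [u [/bij_inv[v [uK vK]] _ uout]] := ext0 (Extension ex).
have h_lin : linear (fun m => (val (v (0, m))).1).
  move=> a x y; rewrite -[_.1 in LHS]/((val_lin _ _).1).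
  have -> : (0, a *: x + y) = a *: (0, x) + (0, y) :> (N * M)%type.
    by congr pair; rewrite /= scaler0 addr0.
  by rewrite !linearP.
exists (mklin h_lin) => m /=; rewrite PBP; congr (f _).
by have := uout (v (0, m)); rewrite vK.
Qed.

Lemma lifts_Ext1_zero M N : lifts M N -> Ext1_zero M N.
Proof.
move=> lMN [E i g ex]; have [s gs] := lMN _ _ _ _ idfun ex.
have [i_inj ig _] : short_exact i g by exact: ex.
have k_lin : linear (fun z : N * M => i z.1 + s z.2).
  by move=> a x y; rewrite /= !linearP scalerDr addrACA.
have giE x : g (i x) = 0 by apply/ig; exists x.
have k_bij : bijective (mklin k_lin).
  apply: bijective_inj_surj => [|y].
    apply: linear_inj => -[x m] /= e.
    have m0 : m = 0 by have := congr1 g e; rewrite linearD giE add0r gs linear0.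
    by move: e; rewrite m0 linear0 addr0 -(linear0 i) => /i_inj ->.
  have /ig[x ix] : g (y - s (g y)) = 0 by rewrite linearB gs subrr.
  by exists (x, g y); rewrite /= ix subrK.
have [f [fK kK]] := bij_inv k_bij.
exists f; split=> /= [|x|y]; first by exists (mklin k_lin).
  by rewrite -[i x]addr0 -(linear0 s); exact: (fK (x, 0)).
by rewrite -{2}(kK y) /= linearD giE add0r gs.
Qed.

Lemma lifts_retract_l M M0 N (s : {linear M -> M0}) (r : {linear M0 -> M}) :
  cancel s r -> lifts M0 N -> lifts M N.
Proof.
move=> sK lM E M' i g f ex; have [h hE] := lM _ _ _ _ (f \o r : {linear _ -> _}) ex.
by exists (h \o s : {linear _ -> _}) => x; rewrite /= hE /= sK.
Qed.

(* A pushout along the section turns [E ->> M'] into [E * N0 ->> M' * N]. *)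
Lemma lifts_retract_r M N N0 (s : {linear N -> N0}) (r : {linear N0 -> N}) :
  cancel s r -> lifts M N0 -> lifts M N.
Proof.
move=> sK lN E M' i g f [i_inj ig g_surj].
have i_lin : linear (fun x : N0 => (i (r x), x - s (r x))).
  move=> a x y; congr pair; rewrite /= !linearP //.
  by rewrite /= scalerDr addrACA.
have g_lin : linear (fun z : E * N0 => (g z.1, r z.2)).
  by move=> a x y; congr pair; rewrite /= !linearP.
have f_lin : linear (fun x => (f x, 0 : N)).
  by move=> a x y; congr pair; rewrite /= ?linearP // scaler0 addr0.
have ex : short_exact (mklin i_lin) (mklin g_lin).
  split=> [x y /= [/i_inj e]|[y n]|[z n]] /=.
  - by rewrite e => /addIr.
  - split=> [[/ig[x ix] rn]|[x [<- <-]]].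
      exists (s x + n); rewrite linearD rn addr0 sK ix; congr pair.
      by rewrite addrAC subrr add0r.
    by congr pair; [apply/ig; exists (r x)|rewrite linearB sK subrr].
  - by have [y gy] := g_surj z; exists (y, s n); rewrite /= gy sK.
have [h hE] := lN _ _ _ _ (mklin f_lin) ex.
have h1_lin : linear (fun x => (h x).1) by move=> a x y; rewrite linearP.
by exists (mklin h1_lin) => x; have [] := hE x.
Qed.

(** The lift is built in two stages. Dividing [E] by the copy of [N1] leaves an extension of [M'] by
    [N2], through which [f] lifts; the result then lifts along [E -> E / N1], whose kernel is
    [N1]. *)
Lemma lifts_ext M N1 N N2 (a : {linear N1 -> N}) (b : {linear N -> N2}) :
  short_exact a b -> lifts M N1 -> lifts M N2 -> lifts M N.
Proof.
move=> [a_inj ab b_surj] l1 l2 E M' i g f [i_inj ig g_surj].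
have baE x : b (a x) = 0 by apply/ab; exists x.
have giE x : g (i x) = 0 by apply/ig; exists x.
pose S := subm (is_submod_im (i \o a : {linear N1 -> E})).
pose q := quot_lin S.
have q0 y : q y = 0 <-> exists x, i (a x) = y by rewrite quot_lin_eq0 submE.
have [j jE] : exists j : {linear N2 -> quotmod S}, forall n, j (b n) = q (i n).
  apply: (comp_surj_ker (c := q \o i : {linear _ -> _})) => // n /ab[x <-].
  by apply/q0; exists x.
have [g' g'E] : exists g' : {linear quotmod S -> M'}, forall y, g' (q y) = g y.
  by apply: comp_surj_ker => [|y /q0[x <-]]; [exact: quot_lin_surj | exact: giE].
have ex2 : short_exact j g'.
  split=> [|z|z].
  - apply: linear_inj => z; have [n <-] := b_surj z.
    by rewrite jE => /q0[x /i_inj <-]; exact: baE.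
  - have [y <-] := quot_lin_surj z; rewrite g'E; split=> [/ig[n <-]|[n2]].
      by exists (b n).
    by have [n <-] := b_surj n2; rewrite jE -g'E => <-; rewrite g'E.
  - by have [y <-] := g_surj z; exists (q y).
have [h2 h2E] := l2 _ _ _ _ f ex2.
have ex1 : short_exact (i \o a : {linear _ -> _}) q.
  split=> [|y|z]; [exact: inj_comp | exact: q0 | exact: quot_lin_surj].
have [h hE] := l1 _ _ _ _ h2 ex1.
by exists h => x; rewrite -g'E hE.
Qed.

Lemma lifts_iso_r M N N' : iso_mod N N' -> lifts M N -> lifts M N'.
Proof.
by move=> [f /bij_inv[g [fK gK]]]; exact: (lifts_retract_r (s := g) (r := f)).
Qed.

Lemma lifts_zero M N : zero_mod N -> lifts M N.
Proof.
move=> N0 E M' i g f [i_inj ig g_surj]; apply: lift_inj => [|p]; last exact: g_surj.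
by apply: linear_inj => y /ig[x <-]; rewrite (N0 x) linear0.
Qed.

Lemma Hom_zero_retract_l M M0 N (s : {linear M -> M0}) (r : {linear M0 -> M}) :
  cancel s r -> Hom_zero M0 N -> Hom_zero M N.
Proof.
by move=> sK h0 f x; rewrite -[x]sK -[f _]/((f \o r : {linear _ -> _}) (s x)) h0.
Qed.

Lemma Hom_zero_sub M N N0 (s : {linear N -> N0}) :
  injective s -> Hom_zero M N0 -> Hom_zero M N.
Proof.
move=> s_inj h0 f x; apply: s_inj; rewrite linear0.
exact: (h0 (s \o f : {linear _ -> _})).
Qed.

Lemma Hom_zero_ext_l M1 M M2 N (a : {linear M1 -> M}) (b : {linear M -> M2}) :
  short_exact a b -> Hom_zero M1 N -> Hom_zero M2 N -> Hom_zero M N.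
Proof.
move=> [_ ab b_surj] h1 h2 f x.
have [d dE] : exists d : {linear M2 -> N}, forall y, d (b y) = f y.
  apply: comp_surj_ker => // y /ab[z <-].
  exact: (h1 (f \o a : {linear _ -> _})).
by rewrite -dE h2.
Qed.

Lemma Hom_zero_ext_r M N1 N N2 (a : {linear N1 -> N}) (b : {linear N -> N2}) :
  short_exact a b -> Hom_zero M N1 -> Hom_zero M N2 -> Hom_zero M N.
Proof.
move=> [a_inj ab _] h1 h2 f x.
have [d dE] : exists d : {linear M -> N1}, forall y, a (d y) = f y.
  by apply: lift_inj => // p; apply/ab/(h2 (b \o f : {linear _ -> _})).
by rewrite -dE h1 linear0.
Qed.

Lemma Hom_zero_iso_l M M' N : iso_mod M M' -> Hom_zero M N -> Hom_zero M' N.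
Proof. by move=> [f /bij_inv[g [fK gK]]]; exact: (@Hom_zero_retract_l _ _ _ g f). Qed.

Lemma fin_gen_surj M N (f : {linear M -> N}) :
  (forall z, exists y, f y = z) -> fin_gen M -> fin_gen N.
Proof.
move=> fs [n [e eE]]; exists n, (fun i => f (e i)) => z.
have [y <-] := fs z; have [a ->] := eE y; exists a.
by rewrite linear_sum; apply: eq_bigr => i _; rewrite linearZ.
Qed.

Lemma fin_gen_ext K M N (f : {linear K -> M}) (g : {linear M -> N}) :
  short_exact f g -> fin_gen K -> fin_gen N -> fin_gen M.
Proof.
move=> [_ fg g_surj] [m [d dE]] [n [e eE]].
pose l i := sval (cid (g_surj (e i))).
have gl i : g (l i) = e i by exact: (svalP (cid (g_surj (e i)))).
exists (m + n)%N,
  (fun k => match split k with inl i => f (d i) | inr j => l j end) => y.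
have [a gy] := eE (g y).
have /fg[x fx] : g (y - \sum_(j < n) a j *: l j) = 0.
  rewrite linearB gy linear_sum /= -sumrB big1 // => j _.
  by rewrite linearZ /= gl subrr.
have [b xE] := dE x.
exists (fun k => match split k with inl i => b i | inr j => a j end).
rewrite big_split_ord /= -[LHS](subrK (\sum_(j < n) a j *: l j)) -fx xE.
rewrite linear_sum; congr (_ + _); apply: eq_bigr => i _.
  by rewrite linearZ (unsplitK (inl i)).
by rewrite (unsplitK (inr i)).
Qed.

Lemma fin_gen0 M : zero_mod M -> fin_gen M.
Proof.
move=> M0; exists 0%N, (fun=> 0) => x; exists (fun=> 0).
by rewrite (M0 x) (M0 (\sum_ _ _)).
Qed.

(** Filtrations are used only through this induction and its converse [filtered_ext]: a filtered
    module is an iterated extension by members of [S]. The isomorphism of a factor with a member of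
    [S] is absorbed into the exact sequence. *)
Lemma filtered_ind (S T : lmodType A -> Prop) :
  (forall M N, iso_mod M N -> T M -> T N) ->
  (forall M, zero_mod M -> T M) ->
  (forall K M N (f : {linear K -> M}) (g : {linear M -> N}),
     short_exact f g -> T K -> S N -> T M) ->
  forall M, filtered S M -> T M.
Proof.
move=> Tiso T0 Text M [s [F [F0 Fs Fsub Fq]]].
suff step i : (i <= s)%N -> T (submod (F i)).
  apply: Tiso (step s (leqnn s)).
  exists (val_lin (F s)); apply: bijective_inj_surj => [|z]; first exact: val_inj.
  by exists (exist _ z (Fs z)).
elim: i => [_|i IHi lis].
  by apply: T0 => x; apply/val_inj/eqP; rewrite linear0 -F0; exact: (valP x).
have [X SX [u u_bij]] := Fq i lis.
have [w wE] : exists w : {linear submod (F i) -> submod (F i.+1)},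
    forall p, val_lin (F i.+1) (w p) = val_lin (F i) p.
  apply: lift_inj => [|p]; first exact: val_inj.
  by exists (exist _ (val p) (Fsub i lis _ (valP p))).
pose q : {linear submod (F i.+1) -> subquot (F i) (F i.+1)} :=
  quot_lin (@restr_pred A M (F i) (F i.+1)).
have ex : short_exact w q.
  split=> [x y e|y|z]; last exact: quot_lin_surj.
    by apply: val_inj; rewrite -[LHS]wE e wE.
  rewrite quot_lin_eq0; split=> [Fy|[x <-]].
    by exists (exist _ (val y) Fy); apply: val_inj; exact: wE.
  by rewrite unfold_in /restr_pred -[val _]/(val_lin _ _) wE; exact: (valP x).
exact: Text (short_exact_isor u_bij ex) (IHi (ltnW lis)) SX.
Qed.

Lemma filtered_zero (S : lmodType A -> Prop) M : zero_mod M -> filtered S M.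
Proof.
move=> M0; exists 0%N, (fun=> subm (is_submod_ker (idfun : {linear M -> M}))).
split=> // x; last by apply/submE; exact: M0.
by apply/idP/eqP => [/submE|->]; last exact/submE.
Qed.

(** The filtration of [K] is pushed forward along [f], and [M] itself is added as step [s.+1], with
    factor [N]. *)
Lemma filtered_ext (S : lmodType A -> Prop) K M N
    (f : {linear K -> M}) (g : {linear M -> N}) :
  short_exact f g -> filtered S K -> S N -> filtered S M.
Proof.
move=> [f_inj fg g_surj] [s [F [F0 Fs Fsub Fq]]] SN.
have fF_sub i : is_submod (fun y => exists2 x, x \in F i & f x = y).
  split=> [|a _ _ [x Fx <-] [y Fy <-]]; first by exists 0; rewrite ?rpred0 ?linear0.
  by exists (a *: x + y); rewrite ?linearP // rpredD // rpredZ.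
have M_sub : is_submod (fun _ : M => True) by [].
pose F' i := if (i <= s)%N then subm (fF_sub i) else subm M_sub.
have F'E i y : (i <= s)%N -> (y \in F' i) <-> exists2 x, x \in F i & f x = y.
  by move=> lis; rewrite /F' lis submE.
have F'T y : y \in F' s.+1 by rewrite /F' ltnn; apply/submE.
exists s.+1, F'; split=> // [x|i|i]; rewrite ?ltnS.
- apply/idP/eqP => [/(F'E _ _ (leq0n s))[z]|->].
    by rewrite F0 => /eqP -> <-; exact: linear0.
  by apply/(F'E _ _ (leq0n s)); exists 0; rewrite ?rpred0 ?linear0.
- rewrite leq_eqVlt => /predU1P[-> x _ //|lis x].
  by case/(F'E _ _ (ltnW lis)) => z Fz <-; apply/(F'E _ _ lis); exists z; rewrite ?Fsub.
rewrite leq_eqVlt => /predU1P[->|lis].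
  exists N => //; apply: (subquot_iso (g := g \o val_lin _ : {linear _ -> _})).
    by move=> z; have [y <-] := g_surj z; exists (exist _ y (F'T y)).
  move=> x; rewrite (F'E _ _ (leqnn s)) /= fg.
  by split=> [[z _ <-]|[z <-]]; exists z.
have [X SX [u u_bij]] := Fq i lis; exists X => //.
(* Below the top, [f] restricts to an isomorphism [w] of the two steps; its inverse carries the
   factor of [F'] back to that of [F]. *)
have [w wE] : exists w : {linear submod (F i.+1) -> submod (F' i.+1)},
    forall p, val_lin (F' i.+1) (w p) = f (val_lin (F i.+1) p).
  apply: (lift_inj (c := f \o val_lin _ : {linear _ -> _})) => [|p].
    exact: val_inj.
  have Fp : f (val p) \in F' i.+1 by apply/(F'E _ _ lis); exists (val p); rewrite ?(valP p).
  by exists (exist _ (f (val p)) Fp).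
have w_bij : bijective w.
  apply: bijective_inj_surj => [x y e|[y Fy]].
    by apply/val_inj/f_inj; rewrite -[LHS]wE e wE.
  have [x Fx fx] := (F'E _ _ lis).1 Fy.
  by exists (exist _ x Fx); apply: val_inj; rewrite -[LHS]/(val_lin _ _) wE.
have [v [wK vK]] := bij_inv w_bij.
pose q : {linear submod (F i.+1) -> subquot (F i) (F i.+1)} :=
  quot_lin (@restr_pred A K (F i) (F i.+1)).
apply: (subquot_iso (g := u \o (q \o v) : {linear _ -> _})) => [z|x].
  have [y <-] := bij_surj u_bij z; have [x <-] := quot_lin_surj y.
  by exists (w x); rewrite /= wK.
rewrite (F'E _ _ (ltnW lis)) -{1}[x]vK -[val _]/(val_lin _ _) wE /=.
have -> : (u (q (v x)) = 0) <-> (q (v x) = 0).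
  by split=> [e|->]; [apply: (bij_inj u_bij); rewrite e linear0 | exact: linear0].
rewrite quot_lin_eq0; split=> [[y Fy /f_inj e]|Fx]; last by exists (val (v x)).
by move: Fy; rewrite e.
Qed.

End ExtLifting.

(** * Restriction of scalars *)

Section Restriction.
Variables (A B : pzRingType) (f : {rmorphism A -> B}).

Definition resmod (f : A -> B) (M : lmodType B) : Type := M.

Section Structure.
Variable M : lmodType B.
HB.instance Definition _ := GRing.Zmodule.on (resmod f M).

Definition resmod_scale (a : A) (x : resmod f M) : resmod f M := f a *: (x : M).

Lemma resmod_scaleA a b x :
  resmod_scale a (resmod_scale b x) = resmod_scale (a * b) x.
Proof. by rewrite /resmod_scale rmorphM scalerA. Qed.
Lemma resmod_scale1 : left_id 1 resmod_scale.
Proof. by move=> x; rewrite /resmod_scale rmorph1 scale1r. Qed.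
Lemma resmod_scaleDr : right_distributive resmod_scale +%R.
Proof. by move=> a x y; exact: scalerDr. Qed.
Lemma resmod_scaleDl x : {morph resmod_scale^~ x : a b / a + b}.
Proof. by move=> a b; rewrite /resmod_scale rmorphD scalerDl. Qed.

HB.instance Definition _ := GRing.Zmodule_isLmodule.Build A (resmod f M)
  resmod_scaleA resmod_scale1 resmod_scaleDr resmod_scaleDl.
End Structure.

Lemma resmodZ (M : lmodType B) a (x : resmod f M) : a *: x = f a *: (x : M) :> M.
Proof. by []. Qed.

Lemma res_linear (M N : lmodType B) (g : {linear M -> N}) :
  linear (g : resmod f M -> resmod f N).
Proof. by move=> a x y; rewrite !resmodZ linearP. Qed.

Definition res_lin (M N : lmodType B) (g : {linear M -> N}) :
  {linear resmod f M -> resmod f N} := mklin (@res_linear M N g).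

Lemma res_exact (K M N : lmodType B) (g : {linear K -> M}) (h : {linear M -> N}) :
  short_exact g h -> short_exact (res_lin g) (res_lin h).
Proof. by []. Qed.
End Restriction.

Lemma fin_gen_family (A : pzRingType) (M : lmodType A) (T : finType) (e : T -> M) :
  (forall x, exists a : T -> A, x = \sum_t a t *: e t) -> fin_gen M.
Proof.
move=> eE; exists #|T|, (fun i => e (enum_val i)) => x.
have [a ->] := eE x; exists (fun i => a (enum_val i)).
by rewrite (reindex (@enum_val T T)) //; apply/onW_bij/enum_val_bij.
Qed.

Lemma fin_gen_res (A B : pzRingType) (f : {rmorphism A -> B}) (M : lmodType B) :
  fin_gen (res_ring f : lmodType A) -> fin_gen M -> fin_gen (resmod f M : lmodType A).
Proof.
move=> [m [d dE]] [n [e eE]].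
apply: (@fin_gen_family A (resmod f M) _
  (fun p : 'I_n * 'I_m => (d p.2 : B) *: e p.1)) => x.
have [b xE] := eE x; pose a i := sval (cid (dE (b i))).
have aE i : b i = \sum_j a i j *: d j by exact: (svalP (cid (dE (b i)))).
exists (fun p => a p.1 p.2); rewrite xE.
rewrite -(pair_bigA _ (fun i j => a i j *: ((d j : B) *: e i : resmod f M))).
apply: eq_bigr => i _; rewrite [in LHS]aE scaler_suml; apply: eq_bigr => j _.
by rewrite resmodZ scalerA.
Qed.

(** * Chain conditions over an artinian ring and Fitting's lemma *)

Section Chains.
Variables (R : comNzRingType) (M : lmodType R).
Implicit Types n : nat.

Definition span n (e : 'I_n -> M) (x : M) : Prop :=
  exists a : 'I_n -> R, x = \sum_i a i *: e i.

Lemma is_submod_span n (e : 'I_n -> M) : is_submod (span e).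
Proof.
split=> [|c _ _ [a ->] [b ->]].
  by exists (fun=> 0); rewrite big1 // => i _; rewrite scale0r.
exists (fun i => c * a i + b i); rewrite scaler_sumr -big_split.
by apply: eq_bigr => i _; rewrite /= scalerDl scalerA.
Qed.

(** Induction on the number of generators: the ideals of possible coefficients of [e ord0] stabilise
    because [R] is artinian, the traces on the span of the other generators by induction.
    Intersecting with a span keeps the whole induction inside one module. *)
Lemma span_chain_stable n (e : 'I_n -> M) (J : nat -> M -> Prop) :
  artinian R -> (forall k, is_submod (J k)) ->
  (forall k x, J k.+1 x -> J k x) ->
  exists k0, forall k, (k0 <= k)%N -> forall x, span e x -> J k0 x -> J k x.
Proof.
move=> artR J_sub J_dec.
have J_le k l x : (k <= l)%N -> J l x -> J k x.
  by move=> /subnK <-; elim: (l - k)%N => // d IHd /J_dec.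
elim: n e => [|n IHn] e.
  by exists 0%N => k _ x [a ->] _; rewrite big_ord0; case: (J_sub k).
pose e' i := e (lift ord0 i).
pose I k (r : R^o) := exists2 u, span e' u & J k (r *: e ord0 - u).
have I_sub k : is_submod (I k).
  split=> [|a r s [u eu Ju] [v ev Jv]].
    exists 0; first by case: (is_submod_span e').
    by rewrite scale0r subr0; case: (J_sub k).
  exists (a *: u + v); first by case: (is_submod_span e') => _; apply.
  rewrite scalerDl opprD addrACA -scalerA -scalerBr.
  by case: (J_sub k) => _; apply.
have [k1 k1P] : exists k1, forall k, (k1 <= k)%N -> subm (I_sub k) =i subm (I_sub k1).
  apply: artR => k r /submE[u eu Ju]; apply/submE.
  by exists u; last exact: J_dec.
have [k2 k2P] := IHn e'.
exists (maxn k1 k2) => k; rewrite geq_max => /andP[k1k k2k] x [a xE] Jx.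
set u := \sum_i a (lift ord0 i) *: e' i.
have eu : span e' u by exists (fun i => a (lift ord0 i)).
have {xE} xE : x = a ord0 *: e ord0 + u by rewrite xE big_ord_recl.
(* An element of [J k] with the same coefficient at [e ord0] as [x]; subtracting it moves the
   problem into the span of [e']. *)
have [v ev Jv] : I k (a ord0).
  apply/(submE (I_sub k)); rewrite k1P //; apply/submE.
  exists (- u); last by rewrite opprK -xE; apply: J_le Jx; exact: leq_maxl.
  by rewrite -sub0r; apply: is_submodB eu; rewrite //; case: (is_submod_span e').
have Jxy : J k (x - (a ord0 *: e ord0 - v)).
  apply: (k2P k k2k).
    rewrite xE opprB [_ + u]addrC addrACA subrr addr0.
    exact: (is_submodD (is_submod_span e')).
  apply: (is_submodB (J_sub k2)); first by apply: J_le Jx; exact: leq_maxr.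
  exact: J_le k2k Jv.
by rewrite -[x](subrK (a ord0 *: e ord0 - v)); exact: (is_submodD (J_sub k)).
Qed.

End Chains.

(* [M] as a module over [R[X]], with [X] acting by the endomorphism [f]. *)
Section PolyModule.
Variables (R : comNzRingType) (M : lmodType R) (f : {linear M -> M}).

Definition polymod (f : M -> M) : Type := M.
HB.instance Definition _ := GRing.Zmodule.on (polymod f).

Definition polymod_scale (p : {poly R}) (x : polymod f) : polymod f :=
  \sum_(k < size p) p`_k *: (iter k f x : M).

Lemma polymod_scale_widen n (p : {poly R}) x : (size p <= n)%N ->
  polymod_scale p x = \sum_(k < n) p`_k *: (iter k f x : M).
Proof.
move=> pn; rewrite /polymod_scale (big_ord_widen n (fun k => p`_k *: (iter k f x : M))) //.
rewrite big_mkcond; apply: eq_bigr => k _; case: ltnP => // pk.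
by rewrite nth_default // scale0r.
Qed.

Lemma polymod_scaleDl x : {morph polymod_scale^~ x : p q / p + q}.
Proof.
move=> p q; pose n := maxn (size (p + q)) (maxn (size p) (size q)).
rewrite !(@polymod_scale_widen n) ?leq_max ?leqnn ?orbT // -big_split.
by apply: eq_bigr => k _; rewrite coefD scalerDl.
Qed.

Lemma polymod_scaleDr : right_distributive polymod_scale +%R.
Proof.
move=> p x y; rewrite /polymod_scale -big_split; apply: eq_bigr => k _.
exact: etrans (congr1 _ (linearD (mklin (iter_linear f k)) x y)) (scalerDr _ _ _).
Qed.

Lemma polymod_scaleC c x : polymod_scale c%:P x = c *: (x : M).
Proof.
by rewrite (@polymod_scale_widen 1) ?size_polyC_leq1 // big_ord1 coefC.
Qed.

Lemma polymod_scale1 : left_id 1 polymod_scale.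
Proof. by move=> x; rewrite polymod_scaleC scale1r. Qed.

Lemma polymod_scaleZ c (p : {poly R}) x :
  polymod_scale (c *: p) x = c *: (polymod_scale p x : M).
Proof.
rewrite (@polymod_scale_widen (size p)) ?size_scale_leq // scaler_sumr.
by apply: eq_bigr => k _; rewrite coefZ scalerA.
Qed.

Lemma polymod_scaleXM p x : polymod_scale ('X * p) x = f (polymod_scale p x).
Proof.
rewrite (@polymod_scale_widen (size p).+1); last first.
  by rewrite (leq_trans (size_polyMleq _ _)) // size_polyX addSn.
rewrite big_ord_recl coefXM scale0r add0r linear_sum; apply: eq_bigr => k _.
by rewrite coefXM linearZ.
Qed.

Lemma polymod_scaleX x : polymod_scale 'X x = f x.
Proof. by rewrite -['X]mulr1 polymod_scaleXM polymod_scale1. Qed.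

Lemma polymod_scaleA p q x :
  polymod_scale p (polymod_scale q x) = polymod_scale (p * q) x.
Proof.
elim/poly_ind: p q x => [|p c IHp] q x.
  by rewrite mul0r /polymod_scale size_poly0 !big_ord0.
rewrite mulrDl !polymod_scaleDl -mulrA -!IHp polymod_scaleXM polymod_scaleX.
by rewrite mul_polyC polymod_scaleZ polymod_scaleC.
Qed.

HB.instance Definition _ := GRing.Zmodule_isLmodule.Build {poly R} (polymod f)
  polymod_scaleA polymod_scale1 polymod_scaleDr polymod_scaleDl.

(** Multiplying the relations by the adjugate replaces [B] by the scalar matrix of its
    determinant. *)
Lemma det_annihilates (S : comNzRingType) (N : lmodType S) n (B : 'M[S]_n)
    (e : 'I_n -> N) :
  (forall i, \sum_j B i j *: e j = 0) -> forall k, \det B *: e k = 0.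
Proof.
move=> Be0 k; transitivity (\sum_j (\adj B *m B) k j *: e j).
  rewrite mul_adj_mx (bigD1 k) //= big1 ?addr0 ?mxE ?eqxx //.
  by move=> j jk; rewrite mxE eq_sym (negPf jk) scale0r.
under eq_bigr do rewrite mxE scaler_suml.
rewrite exchange_big big1 //= => i _; under eq_bigr do rewrite -scalerA.
by rewrite -scaler_sumr Be0 scaler0.
Qed.

(* By Cayley-Hamilton some [1 + X q] annihilates the span, so [X] is injective
   there. *)
Lemma span_ker0 n (e : 'I_n -> M) (a : 'I_n -> 'I_n -> R) :
  (forall i, e i = \sum_j a i j *: f (e j)) ->
  forall x, span e x -> f x = 0 -> x = 0.
Proof.
move=> eE x [c xE] fx0.
(* With ['X] acting as [f], the rows of [B] are the relations [eE]. *)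
pose B : 'M[{poly R}]_n := 1%:M - \matrix_(i, j) ('X * (a i j)%:P).
pose e' i : polymod f := e i.
have Be0 i : \sum_j B i j *: e' j = 0.
  under eq_bigr do rewrite !mxE scalerBl.
  rewrite sumrB (bigD1 i) //= eqxx mulr1n scale1r big1 ?addr0 => [|j]; last first.
    by rewrite eq_sym => /negPf ->; rewrite mulr0n scale0r.
  apply/eqP; rewrite subr_eq0; apply/eqP; rewrite [LHS]eE; apply: eq_bigr => j _.
  by rewrite -[RHS]/(polymod_scale _ _) polymod_scaleXM polymod_scaleC linearZ.
(* At ['X = 0] the matrix [B] becomes the identity. *)
have det0 : (\det B)`_0 = 1.
  rewrite -horner_coef0 -[_.[0]]/(horner_eval 0 _) -det_map_mx.
  suff -> : map_mx (horner_eval 0) B = 1%:M by rewrite det1.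
  apply/matrixP => i j; rewrite !mxE /horner_eval hornerD hornerN hornerM hornerX.
  by rewrite mul0r subr0; case: (i == j); rewrite ?mulr1n ?mulr0n hornerE.
have detx : \det B *: (x : polymod f) = 0.
  rewrite xE scaler_sumr big1 // => i _.
  rewrite -[c i *: e i](polymod_scaleC (c i) (e' i)) -[polymod_scale _ _]/(_ *: e' i).
  by rewrite scalerA mulrC -scalerA det_annihilates // scaler0.
(* Since [f x = 0], only the constant coefficient of the determinant acts on [x]. *)
rewrite -[x]scale1r -det0 -[RHS]detx -[RHS]/(polymod_scale _ _).
rewrite (@polymod_scale_widen (size (\det B)).+1) // big_ord_recl /=.
rewrite big1 ?addr0 // => k _.
have -> : f (iter k f x) = 0.
  by rewrite -iterS iterSr fx0; exact: (linear0 (mklin (iter_linear f k))).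
exact: scaler0.
Qed.
End PolyModule.

Section Fitting.
Variable A : pzRingType.
Implicit Types M X Y : lmodType A.

Lemma indecomposable_internal M (U V : M -> Prop) :
  indecomposable M -> is_submod U -> is_submod V ->
  (forall x, U x -> V x -> x = 0) ->
  (forall x, exists u v, [/\ U u, V v & x = u + v]) ->
  (forall x, U x -> x = 0) \/ (forall x, V x -> x = 0).
Proof.
move=> [_ M_indec] subU subV UV0 UVT.
pose X := submod (subm subU); pose Y := submod (subm subV).
have XP (x : X) : U (val x) by exact: ((submE subU _).1 (valP x)).
have YP (y : Y) : V (val y) by exact: ((submE subV _).1 (valP y)).
have add_lin : linear (fun z : X * Y => val z.1 + val z.2).
  move=> a z z'.
  rewrite -[LHS]/(val_lin _ (a *: z.1 + z'.1) + val_lin _ (a *: z.2 + z'.2)).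
  by rewrite !linearP scalerDr addrACA.
have add_bij : bijective (mklin add_lin).
  apply: bijective_inj_surj => [|z].
    apply: linear_inj => -[x y] /= /eqP; rewrite addr_eq0 => /eqP xy.
    have y0 : val y = 0.
      apply: UV0 => //; rewrite -[val y]opprK -xy -sub0r.
      exact: is_submodB (proj1 subU) (XP x).
    congr pair; apply: val_inj; last exact: y0.
    exact: etrans xy (etrans (congr1 -%R y0) (oppr0 _)).
  by have [u [v [Uu Vv ->]]] := UVT z; exists (subm_in subU Uu, subm_in subV Vv).
have [X0|Y0] : zero_mod X \/ zero_mod Y.
- by apply/M_indec/iso_mod_sym; exists (mklin add_lin).
- by left=> x Ux; exact: (congr1 val (X0 (subm_in subU Ux))).
- by right=> x Vx; exact: (congr1 val (Y0 (subm_in subV Vx))).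
Qed.

(** For large [N], [M] is the direct sum of the kernel and the image of [f^N], and one of them must
    vanish: a zero kernel makes [f] bijective, a zero image makes it nilpotent. *)
Lemma fitting (R : comNzRingType) (h : {rmorphism R -> A}) M (f : {linear M -> M}) :
  artinian R -> fin_gen (res_ring h : lmodType R) -> fin_gen M -> indecomposable M ->
  bijective f \/ exists n, forall x, iter n f x = 0.
Proof.
move=> artR fgA fgM M_indec.
pose MR : lmodType R := resmod h M.
pose fR : {linear MR -> MR} := res_lin h f.
have [n [e eE]] : fin_gen MR by exact: fin_gen_res.
have [k0 k0P] : exists k0, forall k, (k0 <= k)%N -> forall x, span e x ->
    (exists y, iter k0 fR y = x) -> exists y, iter k fR y = x.
  apply: (span_chain_stable e (J := fun k x => exists y, iter k fR y = x)) => //.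
    by move=> k; exact: (is_submod_im (mklin (iter_linear fR k))).
  by move=> k x [y <-]; exists (f y); rewrite iterSr.
(* The successor makes the exponent positive, so that a factor [f] can be split off from [f^N] in
   the bijective case. *)
pose N := k0.+1.
have NP k x : (N <= k)%N -> (exists y, iter N f y = x) -> exists y, iter k f y = x.
  move=> Nk [y yx]; apply: k0P; [exact: ltnW | exact: eE | exists (f y)].
  by rewrite -iterSr.
pose fN := mklin (iter_linear fR N).
have ker0 x : (exists y, iter N f y = x) -> f x = 0 -> x = 0.
  (* The [g i] generate the stable image over [R]. As [f^(N+1)] has the same image, each of them is
     a combination of the [f (g j)], the relation that [span_ker0] asks for. *)
  pose g i := fN (e i).
  have gP i : exists a : 'I_n -> R, g i = \sum_j a j *: fR (g j).
    have [y <-] : exists y, iter N.+1 f y = g i by apply: NP => //; exists (e i).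
    have [a ->] := eE y; exists a; rewrite iterS -[iter _ _ _]/(fN _).
    by rewrite !linear_sum; apply: eq_bigr => j _; rewrite !linearZ.
  move=> [y <-]; apply: (@span_ker0 R MR fR n g (fun i => sval (cid (gP i)))) => [i|].
    exact: (svalP (cid (gP i))).
  have [a ->] := eE y; exists a.
  by rewrite -[LHS]/(fN _) linear_sum; apply: eq_bigr => j _; rewrite linearZ.
have ker_iter0 k x : (exists y, iter N f y = x) -> iter k f x = 0 -> x = 0.
  elim: k x => // k IHk x [y yx]; rewrite iterSr => fx0.
  apply: (ker0 x); first by exists y.
  by apply: (IHk _ _ fx0); exists (f y); rewrite -yx -iterSr.
pose fNA := mklin (iter_linear f N).
have [//|x|U0|V0] := indecomposable_internal M_indec (is_submod_ker fNA) (is_submod_im fNA).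
- by move=> x Ux Vx; exact: ker_iter0 Vx Ux.
- have [y yE] : exists y, iter (N + N) f y = iter N f x.
    by apply: NP; [rewrite leq_addr | exists x].
  exists (x - fNA y), (fNA y); split; [|by exists y|by rewrite subrK].
  apply/eqP; rewrite linearB subr_eq0; apply/eqP.
  by rewrite -[LHS]/(iter N f x) -yE iterD.
- left; apply: bijective_inj_surj => [|x].
    apply: linear_inj => x fx0; apply: U0; rewrite -[LHS]/(iter N f x) iterSr fx0.
    exact: (linear0 (mklin (iter_linear f k0))).
  have [y yE] : exists y, iter (N + N) f y = iter N f x.
    by apply: NP; [rewrite leq_addr | exists x].
  exists (iter k0 f y); apply/eqP; rewrite -iterS -subr_eq0; apply/eqP/U0.
  apply/eqP; rewrite linearB subr_eq0; apply/eqP.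
  by rewrite -[RHS]/(iter N f x) -yE iterD.
- by right; exists N => x; apply: V0; exists x.
Qed.

End Fitting.

(** [fitting] sees the [R]-structure through a ring morphism into [A]; this provides its hypothesis
    for the structure morphism of an algebra. *)
Lemma fin_gen_in_alg (R : comNzRingType) (A : algType R) :
  fin_gen (A : lmodType R) -> fin_gen (res_ring (in_alg A) : lmodType R).
Proof.
move=> [n [e eE]]; exists n, e => x; have [a ->] := eE x; exists a.
by apply: eq_bigr => i _; rewrite -mulr_algl.
Qed.

(** * Direct summands, and induction in the category of filtered modules *)

Section DirectSummands.
Variables (A : pzRingType) (J : finType) (M : J -> lmodType A).

Definition ds_out_fun (j : J) (x : dirsum M) : M j := x j.

Lemma ds_out_linear j : linear (@ds_out_fun j).
Proof. by move=> a x y; rewrite /ds_out_fun !ffunE. Qed.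

Definition ds_out j : {linear dirsum M -> M j} := mklin (@ds_out_linear j).

Definition ds_in_fun (j : J) (x : M j) : dirsum M := [ffun k => dfwith (fun k => 0 : M k) x k].

Lemma ds_in_linear j : linear (@ds_in_fun j).
Proof.
move=> a x y; apply/ffunP => k; rewrite !ffunE.
case: (eqVneq j k) => [jk|jk]; last by rewrite !dfwith_out // scaler0 addr0.
by move: jk; case: k /; rewrite !dfwith_in.
Qed.

Definition ds_in j : {linear M j -> dirsum M} := mklin (@ds_in_linear j).

Lemma ds_inK j : cancel (ds_in j) (ds_out j).
Proof. by move=> x; rewrite /= /ds_out_fun ffunE dfwith_in. Qed.

Lemma ds_out_in j k x : j != k -> ds_out k (ds_in j x) = 0.
Proof. by move=> jk; rewrite /= /ds_out_fun ffunE dfwith_out. Qed.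

End DirectSummands.
Arguments ds_in {A J} M j.
Arguments ds_out {A J} M j.

Lemma Filt_ind (B : pzRingType) (J : Type) (P : J -> Prop) (X : J -> lmodType B)
    (T : lmodType B -> Prop) :
  (forall M N, iso_mod M N -> T M -> T N) ->
  (forall M, zero_mod M -> T M) ->
  (forall (K M : lmodType B) j (f : {linear K -> M}) (g : {linear M -> X j}),
     P j -> short_exact f g -> T K -> T M) ->
  forall M, Filt P X M -> T M.
Proof.
move=> Tiso T0 Text M [_]; apply: filtered_ind => // K M' N f g ex TK [j Pj NX].
by move: N NX g ex => _ -> g ex; exact: Text ex TK.
Qed.

Lemma Filt_zero (B : pzRingType) (J : Type) (P : J -> Prop) (X : J -> lmodType B) M :
  zero_mod M -> Filt P X M.
Proof. by move=> M0; split; [exact: fin_gen0 | exact: filtered_zero]. Qed.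

Lemma Filt_ext (B : pzRingType) (J : Type) (P : J -> Prop) (X : J -> lmodType B)
    (K M : lmodType B) j (f : {linear K -> M}) (g : {linear M -> X j}) :
  fin_gen (X j) -> P j -> short_exact f g -> Filt P X K -> Filt P X M.
Proof.
move=> fgX Pj ex [fgK filK]; split; first exact: fin_gen_ext ex fgK fgX.
by apply: filtered_ext ex filK _; exists j.
Qed.

Lemma lifts_Filt (A : pzRingType) (J : Type) (P : J -> Prop) (X : J -> lmodType A)
    (M N : lmodType A) : (forall j, lifts M (X j)) -> Filt P X N -> lifts M N.
Proof.
move=> lM; apply: Filt_ind => [N1 N2|N0|K N' j f g _ ex lK].
- exact: lifts_iso_r.
- exact: lifts_zero.
- exact: lifts_ext ex lK (lM j).
Qed.

Lemma Hom_zero_Filt (A : pzRingType) (J : Type) (P : J -> Prop) (X : J -> lmodType A)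
    (M N : lmodType A) :
  (forall j, P j -> Hom_zero (X j) N) -> Filt P X M -> Hom_zero M N.
Proof.
move=> h0; apply: (Filt_ind (T := fun M => Hom_zero M N)) => [M1 M2|M0|K M' j f g Pj ex hK].
- exact: Hom_zero_iso_l.
- by move=> M00 f x; rewrite (M00 x) linear0.
- exact: Hom_zero_ext_l ex hK (h0 j Pj).
Qed.

(** This is the exactness of Hom(K,N) -> Ext^1(M',N) -> Ext^1(M,N). A lift over [M] restricts on [K]
    to a map into [N]; that map is zero, so the lift descends to [M']. *)
Lemma lifts_quot (A : pzRingType) (K M M' N : lmodType A)
    (f : {linear K -> M}) (g : {linear M -> M'}) :
  short_exact f g -> Hom_zero K N -> lifts M N -> lifts M' N.
Proof.
move=> [_ fg g_surj] h0 lM E X i p u ex.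
have [h hE] := lM _ _ _ _ (u \o g : {linear _ -> _}) ex.
have [i_inj ip _] : short_exact i p by exact: ex.
have [d dE] : exists d : {linear K -> N}, forall x, i (d x) = h (f x).
  apply: (lift_inj (c := h \o f : {linear _ -> _})) => // x; apply/ip.
  by rewrite /= hE /= (proj2 (fg _) (ex_intro _ x erefl)) linear0.
have [s sE] : exists s : {linear M' -> E}, forall y, s (g y) = h y.
  by apply: comp_surj_ker => // y /fg[x <-]; rewrite -dE h0 linear0.
by exists s => z; have [y <-] := g_surj z; rewrite sE hE.
Qed.

(** * Ext-projective systems are stratifying *)

Section ExtProjective.
Variables (A : pzRingType) (t : nat).
Variables (Theta Q : 'I_t -> lmodType A) (le : rel 'I_t).
Hypothesis epss : ext_projective_system Theta Q le.
Implicit Types (i j k : 'I_t) (P : 'I_t -> Prop) (K M N : lmodType A).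

Lemma epss_lifts i j : lifts (Q i) (Theta j).
Proof.
case: epss => _ _ _ _ [_ /Ext1_zero_lifts ext0].
have lQ := lifts_retract_l (ds_inK (M := Q) (j := i)).
by have := lifts_retract_r (ds_inK (M := Theta) (j := j)); apply; apply: lQ ext0.
Qed.

Lemma epss_resolution i : exists (K : lmodType A) (f : {linear K -> Q i})
  (g : {linear Q i -> Theta i}),
  Filt (fun j => strict le i j) Theta K /\ short_exact f g.
Proof. by case: epss => _ _ _ _ []. Qed.

(** The projection [e] of [Theta i] onto [X] lifts to an endomorphism [e'] of [Q i], as
    Ext^1(Q(i),K(i)) = 0; [e'] need not be idempotent. If [e'] is bijective then [e] is surjective
    and [Y] is zero. If [e'] is nilpotent then so is the idempotent [e], and [X] is zero. *)
Lemma epss_Theta_indecomposable (R : comNzRingType) (h : {rmorphism R -> A}) i :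
  artinian R -> fin_gen (res_ring h : lmodType R) -> indecomposable (Theta i).
Proof.
move=> artR fgA; case: epss => _ Theta_fg Q_fg _ _.
split=> [|X Y [phi phi_bij]]; first by case: (Theta_fg i).
have [psi [phiK psiK]] := bij_inv phi_bij.
have e_lin : linear (fun z : X * Y => (z.1, 0 : Y)).
  by move=> a x y; congr pair; rewrite /= scaler0 addr0.
pose e : {linear Theta i -> Theta i} := psi \o (mklin e_lin \o phi : {linear _ -> _}).
have [K [f [g [filK ex]]]] := epss_resolution i.
have [e' e'E] := lifts_Filt (@epss_lifts i) filK (e \o g : {linear _ -> _}) ex.
have [_ _ g_surj] := ex.
have [Qfg Qind] := Q_fg i.
have [/bij_surj e'_surj|[n e'0]] := fitting e' artR fgA Qfg Qind.
  right=> y; have [x xE] := g_surj (psi (0, y)); have [w wx] := e'_surj x.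
  have := congr1 phi (e'E w); rewrite wx xE /e /= !psiK => -[].
  by [].
left=> x; have eK : e (psi (x, 0)) = psi (x, 0) by rewrite /e /= psiK.
have iterE y : g (iter n e' y) = iter n e (g y).
  by elim: n {e'0} => // n IHn; rewrite !iterS e'E /= IHn.
have [y yE] := g_surj (psi (x, 0)).
have : iter n e (psi (x, 0)) = 0 by rewrite -yE -iterE e'0 linear0.
have -> : iter n e (psi (x, 0)) = psi (x, 0).
  by elim: n {e'0 iterE} => // n IHn; rewrite iterS IHn.
by move=> /(congr1 phi); rewrite psiK linear0 => -[].
Qed.

(** For [j <= i], the factors of K(i) are [Theta k] with [k > i >= j], so Hom(K(i), Theta(j)) = 0
    and [lifts_quot] passes from [Q i] to [Theta i]. The lemma serves twice, over [Lam] and over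
    [Gam]. *)
Lemma epss_stratifying (R : comNzRingType) (h : {rmorphism R -> A}) :
  artinian R -> fin_gen (res_ring h : lmodType R) -> stratifying_system Theta le.
Proof.
move=> artR fgA; case: (epss) => le_lin Theta_fg _ hom0 _.
have [_ le_anti le_trans _] := le_lin.
split=> // [i|i j ji].
  by split; [case: (Theta_fg i) | exact: epss_Theta_indecomposable artR fgA].
apply: lifts_Ext1_zero; have [K [f [g [filK ex]]]] := epss_resolution i.
apply: (lifts_quot ex); last exact: epss_lifts.
apply: Hom_zero_Filt filK => k /andP[ik le_ik]; apply: hom0; rewrite /strict.
rewrite (le_trans _ _ _ ji le_ik) andbT; apply: contraNneq ik => jk.
by apply/eqP/le_anti; rewrite le_ik -jk.
Qed.

End ExtProjective.

(** * Nakayama's lemma *)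

Section Nakayama.

(** Otherwise the left ideal generated by [1 - x] is proper, and Zorn's lemma puts it in a maximal
    left ideal. That ideal also contains [x], hence 1. *)
Lemma jacobson_left_inv (A : nzRingType) (x : A) :
  in_jacobson_radical x -> exists u, u * (1 - x) = 1.
Proof.
move=> jx; apply: contrapT => no_inv.
pose L (y : A) := exists u, u * (1 - x) = y.
(* The empty set has to be allowed for the union of the empty chain. *)
pose P (X : A -> Prop) := [/\ forall a y z, X y -> X z -> X (a * y + z),
  ~ X 1 & (exists y, X y) -> forall y, L y -> X y].
have PL : P L.
  split=> // a _ _ [u <-] [v <-].
  by exists (a * u + v); rewrite mulrDl mulrA.
have [F FP Ftot|m [[mD m1 mL] m_max]] := @classical_sets.Zorn_bigcup A P.
  split=> [a y z [X FX Xy] [Y FY Yz]|[X FX X1]|[y [X FX Xy]] z Lz].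
  - have [XY|YX] := Ftot X Y FX FY.
      by exists Y => //; case: (FP Y FY) => YD _ _; apply: YD => //; exact: XY.
    by exists X => //; case: (FP X FX) => XD _ _; apply: XD => //; exact: YX.
  - by case: (FP X FX).
  - by exists X => //; case: (FP X FX) => _ _; apply=> //; exists y.
have Lm y : L y -> m y.
  move=> Ly; apply: mL; apply: contrapT => m0; apply: (m_max L) => //.
  split=> [z mz|]; first by case: m0; exists z.
  by move=> /(_ _ Ly) my; apply: m0; exists y.
have m_sub : @is_submod A A^o m.
  by split=> //; apply: Lm; exists 0; rewrite mul0r.
have xm : m x.
  apply/(submE m_sub)/jx; split=> [|J mJ J1 y]; first by apply/negP => /submE.
  apply/idP/idP => [Jy|]; last exact: mJ.
  apply/submE; apply: contrapT => my; apply: (m_max (fun y => y \in J)).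
    by split=> [z mz|/(_ y Jy) //]; apply/mJ/submE.
  split=> [a z w|/(negP J1) //|_ z Lz].
    by case: (is_submod_mem J) => _; apply.
  by apply/mJ/submE; exact: Lm.
apply: m1; rewrite -(subrK x 1); have : m (1 - x) by apply: Lm; exists 1; rewrite mul1r.
by move=> m1x; rewrite -[1 - x]mul1r; exact: mD.
Qed.

Variables (A : nzRingType) (I : ideal2 A).

(** The submodule [I X], as the intersection of the submodules containing all products; this spares
    finite sums of products. *)
Definition ideal_span (X : lmodType A) (x : X) : Prop :=
  forall P : X -> Prop, is_submod P -> (forall a y, a \in I -> P (a *: y)) -> P x.

Lemma is_submod_ideal_span (X : lmodType A) : is_submod (@ideal_span X).
Proof.
split=> [P [] //|a x y IXx IXy P subP PI].
by case: (subP) => _; apply; [exact: IXx | exact: IXy].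
Qed.

(** Generators are removed one at a time: [e ord0] is a combination of all generators with
    coefficients in [I], and since [1 - c ord0] has a left inverse it is a combination of the
    others. *)
Lemma nakayama (X : lmodType A) :
  (forall a, a \in I -> in_jacobson_radical a) -> fin_gen X ->
  (forall x : X, ideal_span x) -> zero_mod X.
Proof.
move=> I_rad [n [e eE]] IX.
elim: n e eE => [e eE x|n IHn e eE]; first by have [a ->] := eE x; rewrite big_ord0.
have [c [cI e0E]] : exists c : 'I_n.+1 -> A,
    (forall i, c i \in I) /\ e ord0 = \sum_i c i *: e i.
  apply: (IX (e ord0) (fun y => exists c : 'I_n.+1 -> A,
    (forall i, c i \in I) /\ y = \sum_i c i *: e i)).
    split=> [|a _ _ [c [cI ->]] [d [dI ->]]].
      by exists (fun=> 0); split=> [i|]; rewrite ?rpred0 ?big1 // => i _; rewrite scale0r.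
    exists (fun i => a * c i + d i); split=> [i|].
      by rewrite rpredD ?dI // ideal2Ml.
    rewrite scaler_sumr -big_split; apply: eq_bigr => i _.
    by rewrite /= scalerDl scalerA.
  move=> a y aI; have [b ->] := eE y; exists (fun i => a * b i).
  split=> [i|]; first exact: ideal2Mr.
  by rewrite scaler_sumr; apply: eq_bigr => i _; rewrite scalerA.
have [u u1] := jacobson_left_inv (I_rad _ (cI ord0)).
apply: (IHn (fun i => e (lift ord0 i))) => x; have [a ->] := eE x.
exists (fun i => a ord0 * u * c (lift ord0 i) + a (lift ord0 i)).
have e0u : e ord0 = u *: \sum_(i < n) c (lift ord0 i) *: e (lift ord0 i).
  have : (1 - c ord0) *: e ord0 = \sum_(i < n) c (lift ord0 i) *: e (lift ord0 i).
    by rewrite scalerBl scale1r {1}e0E big_ord_recl addrAC subrr add0r.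
  by move=> <-; rewrite scalerA u1 scale1r.
rewrite big_ord_recl; under [RHS]eq_bigr do rewrite scalerDl.
rewrite big_split; congr (_ + _).
by rewrite e0u !scaler_sumr; apply: eq_bigr => i _; rewrite !scalerA.
Qed.

End Nakayama.

(** * Exactness of the tensor product from a dual basis, and maps out of it *)

Section TensorExact.
Variables (A B : pzRingType) (X : bimod A B).

Lemma tensZ (M : lmodType B) a x (m : M) : a *: tens x m = tens (a *: x) m :> tensor X M.
Proof. exact: tens_scaleE. Qed.

Lemma tens0 (M : lmodType B) x : tens x (0 : M) = 0 :> tensor X M.
Proof. by apply: (addrI (tens x 0)); rewrite -tensDr !addr0. Qed.

Lemma tens_sumr (M : lmodType B) (J : finType) x (m : J -> M) :
  tens x (\sum_j m j) = \sum_j tens x (m j) :> tensor X M.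
Proof. exact: (big_morph (fun m => tens x m : tensor X M) (@tensDr _ _ _ _ x) (tens0 M x)). Qed.

Lemma tens_eq_linear (M : lmodType B) (N : lmodType A) (f g : {linear tensor X M -> N}) :
  (forall x m, f (tens x m) = g (tens x m)) -> f =1 g.
Proof. by apply: tens_ext => s u; rewrite linearB. Qed.

Lemma tfun_mapE (M N : lmodType B) (f : {linear M -> N}) x m :
  tfun_map X f (tens x m) = tens x (f m).
Proof. exact: tens_mapE. Qed.

Lemma tens_map_surj (M N : lmodType B) (f : {linear M -> N}) :
  (forall z, exists y, f y = z) -> forall u, exists s, tfun_map X f s = u.
Proof.
move=> f_surj; apply: tens_ind => [|_ _ [s <-] [u <-]|x n].
- by exists 0; rewrite linear0.
- by exists (s - u); rewrite linearB.
- by have [m <-] := f_surj n; exists (tens x m); rewrite tfun_mapE.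
Qed.

(** The dual basis criterion: the data present the right module [X] as a direct summand of a finite
    free one. *)
Definition dual_basis (J : finType) (e : J -> X) (phi : J -> X -> B) : Prop :=
  [/\ forall j x y, phi j (x + y) = phi j x + phi j y,
      forall j x b, phi j (ract x b) = phi j x * b
    & forall x, x = \sum_j ract (e j) (phi j x)].

Variables (J : finType) (e : J -> X) (phi : J -> X -> B).
Hypothesis e_phi : dual_basis e phi.

(** The map induced by [phi j] under the identification of the tensor product of [B] and [M] with
    [M]. These coordinates are natural in [M] and determine a tensor, by [tens_coord_sum]. *)
Definition tens_coord (M : lmodType B) j : tensor X M -> M :=
  tens_lift (fun x m => phi j x *: m).

Lemma tens_coordE (M : lmodType B) j x (m : M) : tens_coord j (tens x m) = phi j x *: m.
Proof.
have [phiD phiM _] := e_phi.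
apply: tens_liftE => [y z k|y k l|y b k]; rewrite ?phiD ?phiM.
- exact: scalerDl.
- exact: scalerDr.
- by rewrite scalerA.
Qed.

Lemma tens_coordB (M : lmodType B) j : {morph @tens_coord M j : s u / s - u}.
Proof.
have [phiD phiM _] := e_phi.
apply: tens_liftB => [y z k|y k l|y b k]; rewrite ?phiD ?phiM.
- exact: scalerDl.
- exact: scalerDr.
- by rewrite scalerA.
Qed.

Lemma tens_coord0 (M : lmodType B) j : tens_coord j (0 : tensor X M) = 0.
Proof. by rewrite -(subrr 0) tens_coordB subrr. Qed.

Lemma tens_coord_map (M N : lmodType B) (f : {linear M -> N}) j s :
  tens_coord j (tfun_map X f s) = f (tens_coord j s).
Proof.
move: s; apply: tens_ext => [s u|s u|x m].
- by rewrite linearB tens_coordB.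
- by rewrite tens_coordB linearB.
- by rewrite tfun_mapE !tens_coordE linearZ.
Qed.

Lemma tens_coord_sum (M : lmodType B) (s : tensor X M) :
  s = \sum_j tens (e j) (tens_coord j s).
Proof.
move: s; apply: tens_ext => [s u //|s u|x m].
  rewrite -sumrB; apply: eq_bigr => j _; rewrite tens_coordB.
  by apply/eqP; rewrite eq_sym subr_eq -tensDr subrK.
have [phiD phiM phiE] := e_phi; rewrite {1}[x]phiE.
have tens0l : tens 0 m = 0 :> tensor X M.
  by apply: (addrI (tens 0 m)); rewrite -tensDl !addr0.
rewrite (big_morph (fun y => tens y m : tensor X M) (fun y z => tensDl y z m) tens0l).
by apply: eq_bigr => j _; rewrite tens_bal tens_coordE.
Qed.

Lemma tens_map_inj (M N : lmodType B) (f : {linear M -> N}) :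
  injective f -> injective (tfun_map X f).
Proof.
move=> f_inj s u e_su; rewrite [s]tens_coord_sum [u]tens_coord_sum.
apply: eq_bigr => j _; congr tens; apply: f_inj.
by rewrite -!tens_coord_map e_su.
Qed.

(** For exactness in the middle, the coordinates of a tensor killed by [g] are themselves killed by
    [g]; their preimages under [f] reassemble to a tensor. *)
Lemma tens_map_exact (K M N : lmodType B) (f : {linear K -> M}) (g : {linear M -> N}) :
  short_exact f g -> short_exact (tfun_map X f) (tfun_map X g).
Proof.
move=> [f_inj fg g_surj]; split; [exact: tens_map_inj | | exact: tens_map_surj].
move=> s; split=> [gs|[u <-]].
  have fP j : exists y, f y = tens_coord j s.
    by apply/fg; rewrite -tens_coord_map [tfun_map X g s]gs tens_coord0.
  exists (\sum_j tens (e j) (sval (cid (fP j)))).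
  rewrite linear_sum [RHS]tens_coord_sum; apply: eq_bigr => j _.
  by rewrite tfun_mapE; congr tens; exact: (svalP (cid (fP j))).
move: u; apply: tens_ext => [u v|u v|x m]; rewrite ?linearB ?subrr //.
by rewrite !tfun_mapE (proj2 (fg _) (ex_intro _ m erefl)) tens0.
Qed.

End TensorExact.

Section TensorLift.
Variables (A B C : pzRingType) (s : {rmorphism C -> A}) (X : bimod A B).
Variables (M : lmodType B) (Z : lmodType C) (phi : X -> M -> Z).
Hypothesis phiDl : forall x y m, phi (x + y) m = phi x m + phi y m.
Hypothesis phiDr : forall x m n, phi x (m + n) = phi x m + phi x n.
Hypothesis phi_bal : forall x b m, phi (ract x b) m = phi x (b *: m).
Hypothesis phiZ : forall c x m, phi (s c *: x) m = c *: phi x m.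

Lemma tens_lift_linear : linear (tens_lift phi : resmod s (tensor X M) -> Z).
Proof.
have liftB := tens_liftB phiDl phiDr phi_bal.
have liftZ c : forall t : tensor X M, tens_lift phi (s c *: t) = c *: tens_lift phi t.
  apply: tens_ext => [u v|u v|x m].
  - by rewrite scalerBr liftB.
  - by rewrite liftB scalerBr.
  - by rewrite tensZ !(tens_liftE phiDl phiDr phi_bal).
move=> c x y; have lift0 : tens_lift phi (0 : tensor X M) = 0.
  by have := liftB 0 0; rewrite !subrr.
have -> : c *: x + y = (s c *: (x : tensor X M)) - (0 - y) :> tensor X M.
  by rewrite sub0r opprK.
by rewrite !liftB lift0 liftZ sub0r opprK.
Qed.

Definition tens_lift_res : {linear resmod s (tensor X M) -> Z} := mklin tens_lift_linear.

Lemma tens_lift_resE x m : tens_lift_res (tens x m) = phi x m.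
Proof. exact: (tens_liftE phiDl phiDr phi_bal). Qed.
End TensorLift.

Section TensorLiftLin.
Variables (A B : pzRingType) (X : bimod A B).
Variables (M : lmodType B) (Z : lmodType A) (phi : X -> M -> Z).
Hypothesis phiDl : forall x y m, phi (x + y) m = phi x m + phi y m.
Hypothesis phiDr : forall x m n, phi x (m + n) = phi x m + phi x n.
Hypothesis phi_bal : forall x b m, phi (ract x b) m = phi x (b *: m).
Hypothesis phiZ : forall a x m, phi (a *: x) m = a *: phi x m.

Lemma tens_lift_linear_id : linear (tens_lift phi).
Proof. exact: (@tens_lift_linear A B A idfun X M Z phi phiDl phiDr phi_bal phiZ). Qed.

Definition tens_lift_lin : {linear tensor X M -> Z} := mklin tens_lift_linear_id.

Lemma tens_lift_linE x m : tens_lift_lin (tens x m) = phi x m.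
Proof. exact: (tens_liftE phiDl phiDr phi_bal). Qed.
End TensorLiftLin.

(** * The restriction of [G M] to [Lam], and the adjunction *)

Section SplitExtension.
Variables (R : comNzRingType) (Gam Lam : algType R) (I : ideal2 Gam).
Variables (pi : {lrmorphism Gam -> Lam}) (sigma : {lrmorphism Lam -> Gam}).
Hypothesis split : split_by_nilpotent I pi sigma.

Local Notation F := (functorF pi).
Local Notation G := (functorG sigma).
Local Notation XI := (ideal_bimod sigma I).
Local Notation XG := (ring_bimod (idfun : {rmorphism Gam -> Gam}) sigma).
Local Notation XF := (ring_bimod (idfun : {rmorphism Lam -> Lam}) pi).
Implicit Types M : lmodType Lam.
Implicit Types N : lmodType Gam.

Local Notation res N := (resmod sigma N : lmodType Lam).

Lemma pi_sigma x : pi (sigma x) = x.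
Proof. exact: (split_sec split). Qed.

Lemma ipart_in (g : Gam) : g - sigma (pi g) \in I.
Proof. by apply/(split_ker split); rewrite linearB /= pi_sigma subrr. Qed.

(** The projection of [Gam] onto [I] along the image of [sigma]. It respects both actions of [Lam],
    which is why it induces a map on tensor products. *)
Definition ipart (g : XG) : XI := exist _ (g - sigma (pi g)) (ipart_in g).

Lemma ipartD (g h : Gam) : ipart (g + h : Gam) = ipart g + ipart h.
Proof. by apply: val_inj; rewrite /= !rmorphD opprD addrACA. Qed.

Lemma ipart_ract g l : ipart (ract g l) = ract (ipart g) l.
Proof.
apply: val_inj; rewrite /= /res_ract /=.
by rewrite !rmorphM /= pi_sigma mulrBl.
Qed.

Lemma ipartZ l g : ipart (sigma l *: g) = l *: ipart g.
Proof.
apply: val_inj; rewrite /= /GRing.scale /= /res_scale /=.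
by rewrite !rmorphM /= pi_sigma mulrBr.
Qed.

Section Components.
Variable M : lmodType Lam.

(** The unit of the adjunction. [unitG] and [idealG] are the injections, [projG] and [coidealG] the
    projections, of the decomposition of the restriction of [G M]; [splitG] is the resulting sum
    formula. *)
Definition unitG_fun (m : M) : res (G M) := tens (1 : XG) m.

Lemma unitG_linear : linear unitG_fun.
Proof.
move=> l m n; rewrite /unitG_fun tensDr; congr (_ + _).
rewrite -tens_bal resmodZ [RHS]tensZ; congr tens.
by rewrite /ract /= /res_ract mul1r /GRing.scale /= /res_scale mulr1.
Qed.

Definition unitG : {linear M -> res (G M)} := mklin unitG_linear.

Lemma unitGZ g m : g *: (unitG m : G M) = tens (g : XG) m.
Proof.
rewrite [LHS]tensZ; congr tens.
by rewrite /GRing.scale /= /res_scale mulr1.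
Qed.

Definition projG : {linear res (G M) -> M}.
apply: (@tens_lift_res Gam Lam Lam sigma XG M M (fun g m => pi g *: m)).
- by move=> g h m; rewrite linearD scalerDl.
- by move=> g m n; rewrite scalerDr.
- by move=> g l m; rewrite /= /res_ract rmorphM /= pi_sigma scalerA.
- move=> l g m; rewrite -[sigma l *: g]/((sigma l : Gam) * (g : Gam)).
  by rewrite rmorphM /= pi_sigma scalerA.
Defined.

Lemma projGE g m : projG (tens g m) = pi g *: m.
Proof. exact: tens_lift_resE. Qed.

Definition idealG : {linear tensor XI M -> res (G M)}.
apply: (@tens_lift_lin Lam Lam XI M (res (G M)) (fun x m => tens (val x : XG) m)).
- by move=> x y m; exact: tensDl.
- by move=> x m n; exact: tensDr.
- by move=> x l m; exact: tens_bal.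
- by move=> l x m; rewrite resmodZ [RHS]tensZ.
Defined.

Lemma idealGE x m : idealG (tens x m) = tens (val x : XG) m.
Proof. exact: tens_lift_linE. Qed.

Definition coidealG : {linear res (G M) -> tensor XI M}.
apply: (@tens_lift_res Gam Lam Lam sigma XG M (tensor XI M) (fun g m => tens (ipart g) m)).
- by move=> g h m; rewrite ipartD tensDl.
- by move=> g m n; exact: tensDr.
- by move=> g l m; rewrite ipart_ract tens_bal.
- by move=> l g m; rewrite ipartZ [RHS]tensZ.
Defined.

Lemma coidealGE g m : coidealG (tens g m) = tens (ipart g) m.
Proof. exact: tens_lift_resE. Qed.

Lemma unitGK : cancel unitG projG.
Proof. by move=> m; rewrite projGE rmorph1 scale1r. Qed.

Lemma coidealG_unitG m : coidealG (unitG m) = 0.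
Proof.
rewrite coidealGE; have -> : ipart 1 = 0.
  by apply: val_inj; rewrite /= !rmorph1 subrr.
by apply: (addrI (tens 0 m)); rewrite -tensDl !addr0.
Qed.

Lemma idealGK : cancel idealG coidealG.
Proof.
apply: tens_ext => [x y|x y //|x m]; first by rewrite !linearB.
rewrite idealGE coidealGE; congr tens; apply: val_inj => /=.
have /(split_ker split) -> : val x \in I by exact: (valP x).
by rewrite rmorph0 subr0.
Qed.

Lemma projG_idealG x : projG (idealG x) = 0.
Proof.
move: x; apply: tens_ext => [x y|x y|x m]; rewrite ?linearB ?subrr //.
rewrite idealGE projGE.
have /(split_ker split) -> : val x \in I by exact: (valP x).
by rewrite scale0r.
Qed.

Lemma splitG (x : res (G M)) : x = unitG (projG x) + idealG (coidealG x).
Proof.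
move: x; apply: tens_ext => [x y //|x y|g m].
  by rewrite !linearB /= opprD addrACA.
rewrite projGE coidealGE idealGE linearZ /= resmodZ /= unitGZ -tensDl.
by congr tens; rewrite /= addrCA subrr addr0.
Qed.

Lemma exact_idealG_projG : short_exact idealG projG.
Proof.
split=> [|x|m]; first exact: can_inj idealGK.
  split=> [x0|[y <-]]; last exact: projG_idealG.
  by exists (coidealG x); rewrite [RHS]splitG x0 linear0 add0r.
by exists (unitG m); exact: unitGK.
Qed.

Variable N : lmodType Gam.

Definition adjG (f : {linear M -> res N}) : {linear G M -> N}.
apply: (@tens_lift_lin Gam Lam XG M N (fun g m => (g : Gam) *: (f m : N))).
- by move=> g h m; rewrite scalerDl.
- by move=> g m n; rewrite linearD scalerDr.
- by move=> g l m; rewrite linearZ /= resmodZ scalerA.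
- by move=> g h m; rewrite scalerA.
Defined.

Lemma adjGE f g m : adjG f (tens (g : XG) m) = (g : Gam) *: (f m : N).
Proof. exact: tens_lift_linE. Qed.

Lemma adjG_unitG f m : adjG f (unitG m) = f m.
Proof. exact: etrans (adjGE f 1 m) (scale1r _). Qed.

Lemma G_ext (f h : {linear G M -> N}) :
  (forall m, f (unitG m) = h (unitG m)) -> f =1 h.
Proof.
by move=> fh; apply: tens_eq_linear => g m; rewrite -unitGZ !linearZ /= fh.
Qed.
End Components.

End SplitExtension.

(** * Additivity of the tensor functor *)

Section TensorFunctorial.
Variables (A B : pzRingType) (X : bimod A B).
Implicit Types M N : lmodType B.

Lemma tfun_cancel M N (f : {linear M -> N}) (g : {linear N -> M}) :
  cancel f g -> cancel (tfun_map X f) (tfun_map X g).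
Proof.
move=> fK x; rewrite -[LHS]/((tfun_map X g \o tfun_map X f) x) -tfun_comp.
rewrite -[RHS](@tfun_id _ _ X M x); apply: tfun_ext => m; exact: fK.
Qed.

Lemma tfun_iso M N : iso_mod M N -> iso_mod (tfun_obj X M) (tfun_obj X N).
Proof.
move=> [f /bij_inv[g [fK gK]]]; exists (tfun_map X f).
by exists (tfun_map X g); exact: tfun_cancel.
Qed.

Lemma tens_zero M : zero_mod M -> zero_mod (tensor X M).
Proof.
move=> M0; apply: tens_ind => [//|_ _ -> ->|x m]; first by rewrite subrr.
by rewrite (M0 m) tens0.
Qed.

Lemma tens_prod_iso M N :
  iso_mod (tensor X (M * N)%type) (tensor X M * tensor X N)%type.
Proof.
have inl_lin : linear (fun x : M => (x, 0 : N)).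
  by move=> a x y; congr pair; rewrite /= scaler0 addr0.
have inr_lin : linear (fun y : N => (0 : M, y)).
  by move=> a x y; congr pair; rewrite /= scaler0 addr0.
pose p1 : {linear (M * N)%type -> M} := fst.
pose p2 : {linear (M * N)%type -> N} := snd.
pose i1 := mklin inl_lin; pose i2 := mklin inr_lin.
have p12_lin : linear (fun t => (tfun_map X p1 t, tfun_map X p2 t)).
  by move=> a x y; congr pair; rewrite /= linearP.
exists (mklin p12_lin); apply: bijective_inj_surj => [|[u v]].
  apply: linear_inj => t [p1t p2t].
  suff -> : t = tfun_map X i1 (tfun_map X p1 t) + tfun_map X i2 (tfun_map X p2 t).
    by rewrite [tfun_map X p1 t]p1t [tfun_map X p2 t]p2t !linear0 addr0.
  move: t {p1t p2t}; apply: tens_ext => [s t //|s t|x [m n]].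
    by rewrite !linearB addrACA opprD.
  by rewrite !tfun_mapE -tensDr; congr tens; congr pair; rewrite /= ?addr0 ?add0r.
have p1i2 w : tfun_map X p1 (tfun_map X i2 w) = 0.
  move: w; apply: tens_ext => [s t|s t|x n]; rewrite ?linearB ?subrr //.
  by rewrite !tfun_mapE tens0.
have p2i1 w : tfun_map X p2 (tfun_map X i1 w) = 0.
  move: w; apply: tens_ext => [s t|s t|x n]; rewrite ?linearB ?subrr //.
  by rewrite !tfun_mapE tens0.
exists (tfun_map X i1 u + tfun_map X i2 v); congr pair; rewrite linearD.
  by rewrite p1i2 addr0; exact: tfun_cancel.
by rewrite p2i1 add0r; exact: tfun_cancel.
Qed.

(** A retract is enough to compare tensoring with direct sums, because [lifts] passes to retracts in
    both arguments. *)
Lemma tens_dirsum_retract (J : finType) (M : J -> lmodType B) :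
  exists (s : {linear dirsum (fun j => tfun_obj X (M j)) -> tensor X (dirsum M)})
         (r : {linear tensor X (dirsum M) -> dirsum (fun j => tfun_obj X (M j))}),
    cancel s r.
Proof.
have s_lin : linear (fun x : dirsum (fun j => tfun_obj X (M j)) =>
    \sum_j tfun_map X (ds_in M j) (x j)).
  move=> a x y; rewrite scaler_sumr -big_split; apply: eq_bigr => j _.
  by rewrite !ffunE linearP.
have r_lin : linear (fun u => [ffun j => tfun_map X (ds_out M j) u]
    : dirsum (fun j => tfun_obj X (M j))).
  by move=> a x y; apply/ffunP => j; rewrite !ffunE linearP.
exists (mklin s_lin), (mklin r_lin) => x; apply/ffunP => k.
rewrite /= ffunE linear_sum (bigD1 k) //= big1 ?addr0 => [|j jk].
  by apply: tfun_cancel; exact: ds_inK.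
move: (x j); apply: tens_ext => [u v|u v|y m]; rewrite ?linearB ?subrr //.
by rewrite !tfun_mapE ds_out_in // tens0.
Qed.

End TensorFunctorial.

Lemma short_exact_isom (A : pzRingType) (K M M' N : lmodType A) (f : {linear K -> M})
    (g : {linear M -> N}) (u : {linear M -> M'}) (v : {linear M' -> M}) :
  cancel u v -> cancel v u -> short_exact f g ->
  short_exact (u \o f : {linear K -> M'}) (g \o v : {linear M' -> N}).
Proof.
move=> uK vK [f_inj fg g_surj]; split=> [|y|z].
- exact: inj_comp (can_inj uK) f_inj.
- rewrite /= fg; split=> [[x fx]|[x <-]]; exists x; last by rewrite uK.
  by rewrite fx vK.
- by have [y <-] := g_surj z; exists (u y); rewrite /= uK.
Qed.

(** The isomorphism is absorbed into the last exact sequence of the filtration, so the induction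
    quantifies over all modules isomorphic to [M]. *)
Lemma Filt_iso (A : pzRingType) (J : Type) (P : J -> Prop) (X : J -> lmodType A)
    (M M' : lmodType A) : iso_mod M M' -> Filt P X M -> Filt P X M'.
Proof.
move=> MM' filM; split.
  by case: (MM') => u /bij_surj u_surj; case: filM => fgM _; exact: fin_gen_surj fgM.
move: M filM M' MM'.
apply: (@Filt_ind _ _ _ _ (fun M => forall M', iso_mod M M' -> filtered _ M')).
- by move=> M N MN IH N' NN'; apply: IH; exact: iso_mod_trans NN'.
- by move=> M M0 N MN; apply: filtered_zero; exact: iso_zero_mod M0.
- move=> K M j f g Pj ex IH M' [u /bij_inv[v [uK vK]]].
  apply: filtered_ext (short_exact_isom uK vK ex) (IH _ (iso_mod_refl K)) _.
  by exists j.
Qed.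

(** * Hom, extensions and indecomposability under [F] and [G] *)

Section ChangeOfRings.
Variables (R : comNzRingType) (Gam Lam : algType R) (I : ideal2 Gam).
Variables (pi : {lrmorphism Gam -> Lam}) (sigma : {lrmorphism Lam -> Gam}).
Hypothesis split : split_by_nilpotent I pi sigma.

Local Notation F := (functorF pi).
Local Notation G := (functorG sigma).
Local Notation XI := (ideal_bimod sigma I).
Local Notation XG := (ring_bimod (idfun : {rmorphism Gam -> Gam}) sigma).
Local Notation XF := (ring_bimod (idfun : {rmorphism Lam -> Lam}) pi).
Implicit Types M : lmodType Lam.
Implicit Types N : lmodType Gam.

Local Notation res N := (resmod sigma N : lmodType Lam).
Local Notation projG := (projG split).
Local Notation coidealG := (coidealG split).

(** [projG] was built as a [Lam]-linear map; its compatibility with all of [Gam] through [pi] is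
    what makes [counitFG] balanced. *)
Lemma projGZ M (g : Gam) (x : G M) : projG M (g *: x : G M) = pi g *: projG M x.
Proof.
move: x; apply: tens_ext => [x y|x y|h m].
- by rewrite scalerBr linearB.
- by rewrite linearB scalerBr.
by rewrite [_ *: _ in LHS]tensZ !projGE rmorphM scalerA.
Qed.

Lemma projG_map M M' (f : {linear M -> M'}) (x : G M) :
  projG M' (fmap G f x) = f (projG M x).
Proof.
move: x; apply: tens_ext => [x y|x y|h m]; rewrite ?linearB //.
by rewrite [fmap _ _ _]tfun_mapE !projGE linearZ.
Qed.

Lemma fmapG_unitG M M' (f : {linear M -> M'}) m :
  fmap G f (unitG sigma M m) = unitG sigma M' (f m).
Proof. exact: tfun_mapE. Qed.

Definition counitFG M : {linear F (G M) -> M}.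
apply: (@tens_lift_lin Lam Gam XF (G M) M (fun l x => (l : Lam) *: projG M x)).
- by move=> k l x; rewrite scalerDl.
- by move=> l x y; rewrite linearD scalerDr.
- by move=> l g x; rewrite projGZ scalerA.
- by move=> k l x; rewrite scalerA.
Defined.

Lemma counitFGE M (l : Lam) (x : G M) : counitFG M (tens (l : XF) x) = l *: projG M x.
Proof. exact: tens_lift_linE. Qed.

Lemma counitFG_natural M M' (f : {linear M -> M'}) x :
  counitFG M' (fmap F (fmap G f) x) = f (counitFG M x).
Proof.
move: x; apply: tens_ext => [x y|x y|l y]; rewrite ?linearB //.
by rewrite [fmap _ _ _]tfun_mapE !counitFGE projG_map linearZ.
Qed.

(** The inverse is [d]. Moving scalars across both tensor signs, with [pi (sigma k) = k], brings l
    (x) (g (x) m) to the form 1 (x) (1 (x) l pi(g) m). *)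
Lemma counitFG_bij M : bijective (counitFG M).
Proof.
pose d m : F (G M) := tens (1 : XF) (unitG sigma M m : G M).
have counitK m : counitFG M (d m) = m by rewrite counitFGE scale1r unitGK.
apply: bijective_inj_surj => [|m]; last by exists (d m).
have dB : {morph d : m n / m - n}.
  move=> m n; rewrite /d linearB.
  by apply/eqP; rewrite eq_sym subr_eq -tensDr subrK.
suff dK x : d (counitFG M x) = x by exact: can_inj dK.
move: x; apply: tens_ext => [x y|x y //|l x]; first by rewrite linearB dB.
rewrite counitFGE; move: x; apply: tens_ext => [x y|x y|g m].
- by rewrite linearB scalerBr dB.
- by apply/eqP; rewrite eq_sym subr_eq -tensDr subrK.
have dZ k : d (k *: m) = tens (k : XF) (unitG sigma M m : G M).
  rewrite /d linearZ /= resmodZ -tens_bal; congr tens.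
  exact: etrans (mul1r _) (pi_sigma split k).
have gm : tens (g : XG) m = g *: (unitG sigma M m : G M) :> G M by rewrite unitGZ.
rewrite projGE scalerA dZ gm.
exact: (@tens_bal _ _ XF (G M) l g (unitG sigma M m : G M)).
Qed.

Lemma counitFG_iso_id (P : lmodType Lam -> Prop) : comp_iso_id P G F.
Proof.
exists (fun M _ => counitFG M); split=> [M _|M N _ _ f x].
  exact: counitFG_bij.
exact: counitFG_natural.
Qed.

Lemma fin_gen_G M : fin_gen M -> fin_gen (G M).
Proof.
move=> [n [e eE]]; exists n, (fun i => unitG sigma M (e i) : G M).
apply: tens_ind => [|_ _ [a ->] [b ->]|g m].
- by exists (fun=> 0); rewrite big1 // => i _; rewrite scale0r.
- exists (fun i => a i - b i); rewrite -sumrB; apply: eq_bigr => i _.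
  by rewrite scalerBl.
- have [a ->] := eE m; exists (fun i => (g : Gam) * sigma (a i)).
  rewrite tens_sumr; apply: eq_bigr => i _.
  by rewrite -unitGZ linearZ /= resmodZ scalerA.
Qed.

(** [F N] maps onto the quotient of [N] by [I N] through [phi], so its vanishing gives N = I N, and
    Nakayama's lemma applies. *)
Lemma F_zero N : fin_gen N -> zero_mod (F N) -> zero_mod N.
Proof.
move=> fgN FN0; apply: (nakayama (split_rad split) fgN) => x.
pose q := quot_lin (subm (is_submod_ideal_span I N)).
have qI g (y : N) : g \in I -> q (g *: y) = 0.
  by move=> gI; apply/quot_lin_eq0/submE => P subP; apply.
pose phi (l : XF) (y : N) := q (sigma (l : Lam) *: y).
have phiDl k l y : phi (k + l) y = phi k y + phi l y.
  by rewrite /phi rmorphD scalerDl linearD.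
have phiDr l y z : phi l (y + z) = phi l y + phi l z.
  by rewrite /phi scalerDr linearD.
have phi_bal l g y : phi (ract l g) y = phi l (g *: y).
  apply/eqP; rewrite -subr_eq0 /phi -linearB scalerA -scalerBl; apply/eqP/qI.
  (* The two sides differ by the action of sigma(l) (sigma(pi(g)) - g), an element of [I]. *)
  rewrite -[ract l g]/((l : Lam) * pi g) rmorphM -mulrBr ideal2Ml //.
  by apply/(split_ker split); rewrite rmorphB /= (pi_sigma split) subrr.
have : phi 1 x = 0.
  rewrite -(tens_liftE phiDl phiDr phi_bal) (FN0 (tens (1 : XF) x)).
  by have := tens_liftB phiDl phiDr phi_bal 0 0; rewrite !subrr.
by rewrite /phi rmorph1 scale1r => /quot_lin_eq0/submE.
Qed.

Lemma indecomposable_G M : fin_gen M -> indecomposable M -> indecomposable (G M).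
Proof.
move=> fgM [M_nz M_indec]; split=> [GM0|X Y GM_XY].
  apply: M_nz => m; rewrite -[m](unitGK split) (GM0 (unitG sigma M m)).
  exact: linear0.
have [u /bij_surj u_surj] := GM_XY.
(* [F_zero] asks for finite generation, which [X] and [Y] inherit as quotients of [G M]. *)
have fgX : fin_gen X.
  apply: (@fin_gen_surj _ _ _ (fst \o u : {linear _ -> _})) (fin_gen_G fgM) => x.
  by have [z zx] := u_surj (x, 0); exists z; rewrite /= zx.
have fgY : fin_gen Y.
  apply: (@fin_gen_surj _ _ _ (snd \o u : {linear _ -> _})) (fin_gen_G fgM) => y.
  by have [z zy] := u_surj (0, y); exists z; rewrite /= zy.
have FGM : iso_mod (F (G M)) M by exists (counitFG M); exact: counitFG_bij.
have FGM_XY : iso_mod (F (G M)) (F X * F Y)%type.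
  exact: iso_mod_trans (tfun_iso XF GM_XY) (tens_prod_iso XF X Y).
have [FX0|FY0] := M_indec _ _ (iso_mod_trans (iso_mod_sym FGM) FGM_XY).
  by left; exact: F_zero FX0.
by right; exact: F_zero FY0.
Qed.

(** Restriction is exact, so the adjoint of [f] lifts over [Lam]; the adjoint of that lift is the
    one sought. *)
Lemma lifts_G M N : lifts M (res N) -> lifts (G M) N.
Proof.
move=> lM E N' i g f ex.
have [h hE] := lM _ _ _ _ (res_lin sigma f \o unitG sigma M : {linear M -> res N'})
  (res_exact sigma ex).
exists (adjG h) => x; apply: (G_ext (f := g \o adjG h : {linear _ -> _}) (h := f)) => m.
exact: etrans (congr1 g (adjG_unitG h m)) (hE m).
Qed.

Lemma lifts_GG M M' : lifts M M' -> lifts M (tensor XI M') -> lifts (G M) (G M').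
Proof.
by move=> l1 l2; apply: lifts_G; exact: lifts_ext (exact_idealG_projG split M') l2 l1.
Qed.

(** [f] is determined by its composite with the unit. The component of this composite in
    [tensor XI M'] vanishes, and the remaining component is [h]. *)
Lemma G_full M M' (f : {linear G M -> G M'}) :
  Hom_zero M (tensor XI M') -> exists h : {linear M -> M'}, f =1 fmap G h.
Proof.
move=> h0; pose fu : {linear M -> res (G M')} := res_lin sigma f \o unitG sigma M.
exists (projG M' \o fu : {linear _ -> _}); apply: G_ext => m.
have k0 : coidealG M' (fu m) = 0 by exact: (h0 (coidealG M' \o fu : {linear _ -> _}) m).
by rewrite fmapG_unitG -[LHS]/(fu m) [LHS](splitG split) k0 linear0 addr0.
Qed.

Lemma Hom_zero_G M M' :
  Hom_zero M M' -> Hom_zero M (tensor XI M') -> Hom_zero (G M) (G M').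
Proof.
move=> h1 h2 f x; have [h ->] := G_full f h2.
apply: (G_ext (f := fmap G h) (h := \0)) => m.
by rewrite fmapG_unitG h1 linear0.
Qed.

(* [E0] is cut out of [E] by a splitting of the [tensor XI M']-part of the
   restricted extension. *)
Lemma G_extension M M' (E : lmodType Gam) (i : {linear G M' -> E}) (g : {linear E -> G M}) :
  (forall (K L N : lmodType Lam) (a : {linear K -> L}) (b : {linear L -> N}),
     short_exact a b -> short_exact (fmap G a) (fmap G b)) ->
  short_exact i g -> lifts M (tensor XI M') ->
  exists (E0 : lmodType Lam) (a : {linear M' -> E0}) (b : {linear E0 -> M}),
    short_exact a b /\ iso_mod (G E0) E.
Proof.
move=> G_exact [i_inj ig g_surj] lM.
pose ir : {linear res (G M') -> res E} := res_lin sigma i.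
pose gr : {linear res E -> res (G M)} := res_lin sigma g.
have gi x : g (i x) = 0 by apply/ig; exists x.
(* Dividing by the copy of [M'] in [E] leaves an extension of the restriction of [G M] by
   [tensor XI M']. *)
pose S := subm (is_submod_im (ir \o unitG sigma M' : {linear M' -> res E})).
pose q := quot_lin S.
have q0 y : q y = 0 <-> exists m, i (unitG sigma M' m) = y by rewrite quot_lin_eq0 submE.
pose j : {linear tensor XI M' -> quotmod S} :=
  q \o (ir \o idealG I sigma M' : {linear _ -> res E}).
have [gb gbE] : exists gb : {linear quotmod S -> res (G M)}, forall y, gb (q y) = gr y.
  by apply: comp_surj_ker => [|y /q0[m <-]]; [exact: quot_lin_surj | exact: gi].
have ex : short_exact j gb.
  split=> [|z|z].
  - apply: linear_inj => x /q0[m /i_inj e].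
    rewrite -[x](idealGK split) -e; exact: coidealG_unitG.
  - have [y <-] := quot_lin_surj z; rewrite gbE; split=> [/ig[x <-]|[x jx]].
      pose c := idealG I sigma M' (coidealG M' x).
      have /q0 : exists m, i (unitG sigma M' m) = ir c - ir x.
        exists (- projG M' x); rewrite -linearB; congr (ir _).
        by rewrite {2}[x](splitG split) linearN opprD addrCA subrr addr0.
      rewrite linearB => /eqP; rewrite subr_eq0 => /eqP e.
      by exists (coidealG M' x).
    by rewrite -gbE -jx gbE; exact: gi.
  - by have [y <-] := g_surj z; exists (q y).
(* The unit of [M] lifts to this quotient; [E0] is the preimage in [E] of the image of the lift,
   hence an extension of [M] by [M']. *)
have [h hE] := lM _ _ _ _ (unitG sigma M) ex.
pose P (y : res E) := exists m, q y = h m.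
have subP : is_submod P.
  split=> [|l x y [m xm] [n yn]]; first by exists 0; rewrite !linear0.
  by exists (l *: m + n); rewrite !linearP xm yn.
pose E0 : lmodType Lam := submod (subm subP); pose v : {linear E0 -> res E} := val_lin _.
have vP (y : E0) : exists m, q (v y) = h m by exact: ((submE subP _).1 (valP y)).
pose b : {linear E0 -> M} := projG M \o (gr \o v : {linear _ -> _}).
have bE y m : q (v y) = h m -> gr (v y) = unitG sigma M m /\ b y = m.
  move=> qy; have grv : gr (v y) = unitG sigma M m by rewrite -gbE qy hE.
  by split=> //; exact: etrans (congr1 (projG M) grv) (unitGK split m).
have [a aE] : exists a : {linear M' -> E0}, forall m, v (a m) = ir (unitG sigma M' m).
  apply: (lift_inj (c := ir \o unitG sigma M' : {linear _ -> _})) => [|m].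
    exact: val_inj.
  have Pm : P (ir (unitG sigma M' m)).
    by exists 0; rewrite linear0; apply/q0; exists m.
  by exists (subm_in subP Pm).
have ab : short_exact a b.
  split=> [m n e|y|m].
  - have: ir (unitG sigma M' m) = ir (unitG sigma M' n) by rewrite -!aE e.
    by move=> /i_inj/(congr1 (projG M')); rewrite !(unitGK split).
  - split=> [b0|[m <-]].
      have [m qy] := vP y; have [_ bm] := bE _ _ qy.
      have /q0[n ny] : q (v y) = 0 by rewrite qy -bm b0 linear0.
      by exists n; apply: val_inj; exact: etrans (aE n) ny.
    have qa : q (v (a m)) = h 0 by rewrite linear0 aE; apply/q0; exists m.
    by have [_ ->] := bE _ _ qa.
  - have [y qy] := quot_lin_surj (h m).
    have Py : P y by exists m.
    by exists (subm_in subP Py); have [_ ->] := bE (subm_in subP Py) m qy.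
exists E0, a, b; split=> //.
have [Ga_inj Gab Gb_surj] := G_exact _ _ _ _ _ ab.
(* The adjoint of the inclusion is a map of extensions that is the identity on both ends, and the
   five lemma makes it bijective. *)
pose Phi : {linear G E0 -> E} := adjG v.
have Phi_a x : Phi (fmap G a x) = i x.
  apply: (G_ext (f := Phi \o fmap G a : {linear _ -> _}) (h := i)) => m.
  rewrite -[LHS]/(Phi (fmap G a (unitG sigma M' m))) fmapG_unitG adjG_unitG.
  exact: aE.
have g_Phi x : g (Phi x) = fmap G b x.
  apply: (G_ext (f := g \o Phi : {linear _ -> _}) (h := fmap G b)) => y.
  rewrite fmapG_unitG -[LHS]/(g (Phi (unitG sigma E0 y))) adjG_unitG; have [m qy] := vP y.
  by have [gv ->] := bE _ _ qy.
exists Phi; apply: bijective_inj_surj => [|y].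
  apply: linear_inj => x x0.
  have /Gab[z zx] : fmap G b x = 0 by rewrite -g_Phi x0 linear0.
  have z0 : z = 0 by apply: i_inj; rewrite -Phi_a zx x0 linear0.
  by rewrite -zx z0 linear0.
have [x xy] := Gb_surj (g y).
have /ig[z zE] : g (y - Phi x) = 0 by rewrite linearB g_Phi xy subrr.
by exists (fmap G a z + x); rewrite linearD Phi_a zE subrK.
Qed.

End ChangeOfRings.

(** * Dual bases of [I] and of [Gam] over [Lam] *)

Section DualBases.
Variables (R : comNzRingType) (Gam Lam : algType R) (I : ideal2 Gam).
Variables (pi : {lrmorphism Gam -> Lam}) (sigma : {lrmorphism Lam -> Gam}).
Hypothesis split : split_by_nilpotent I pi sigma.
Hypothesis Gam_fg : fin_gen (Gam : lmodType R).
Hypothesis I_proj : projective (rmod (ideal_bimod sigma I)).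

Local Notation XI := (ideal_bimod sigma I).
Local Notation XG := (ring_bimod (idfun : {rmorphism Gam -> Gam}) sigma).

(* [I] is finitely generated on the right over [Lam]: it is the image of [Gam]
   under the R-linear map [g |-> g - sigma (pi g)]. *)
Lemma ideal_dual_basis : exists n (e : 'I_n -> XI) (phi : 'I_n -> XI -> Lam),
  dual_basis e phi.
Proof.
have [n [d dE]] := Gam_fg.
pose e i : XI := ipart split (d i).
pose V : lmodType Lam^c := {ffun 'I_n -> Lam^c^o}.
have g_lin : linear (fun v : V => \sum_i (v i : Lam^c) *: (e i : rmod XI)).
  move=> a v w; rewrite scaler_sumr -big_split; apply: eq_bigr => i _.
  by rewrite !ffunE scalerDl scalerA.
have g_surj (x : rmod XI) : exists v, mklin g_lin v = x.
  have /(split_ker split) px : val x \in I by exact: (valP x).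
  have [a xE] := dE (val x); exists [ffun i => (a i)%:A]; apply: val_inj.
  (* An [x] in [I] equals x - sigma(pi(x)); expanding [x] in the [R]-generators [d i] expresses it
     through the [e i], with the scalars of [R] moved to the right. *)
  transitivity (\sum_i (d i - sigma (pi (d i))) * sigma (a i)%:A).
    have valD : {morph (fun y : rmod XI => \val (y : XI)) : y z / y + z} by [].
    rewrite /= (big_morph _ valD (erefl : \val (0 : XI) = 0)).
    by apply: eq_bigr => i _; rewrite ffunE.
  transitivity (\sum_i a i *: d i - sigma (pi (\sum_i a i *: d i))).
    rewrite (raddf_sum pi) (raddf_sum sigma) -sumrB; apply: eq_bigr => i _ /=.
    have -> : sigma (pi (a i *: d i)) = a i *: sigma (pi (d i)).
      by rewrite [pi _]linearZ [LHS]linearZ.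
    by rewrite [sigma _%:A]linearZ /= rmorph1 mulrBl -!scalerAr !mulr1.
  by rewrite [X in pi X](esym xE) px rmorph0 subr0 -xE.
(* Projectivity splits the surjection from the free module; the coordinates of the splitting are
   [phi]. *)
have [h hE] := I_proj idfun g_surj.
exists n, e, (fun i x => h x i); split=> [i x y|i x b|x].
- by rewrite (linearD h) ffunE.
- by rewrite -[ract x b]/((b : Lam^c) *: (x : rmod XI)) linearZ ffunE.
- exact: esym (hE x).
Qed.

(** As a right [Lam]-module, [Gam] is the sum of the image of [sigma], free on 1 with coordinate
    [pi], and of [I]. *)
Lemma ring_dual_basis n (e : 'I_n -> XI) (phi : 'I_n -> XI -> Lam) :
  dual_basis e phi ->
  exists (J : finType) (e' : J -> XG) (phi' : J -> XG -> Lam), dual_basis e' phi'.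
Proof.
move=> [phiD phiM phiE].
exists (unit + 'I_n)%type,
  (fun j => match j with inl _ => 1 : Gam | inr i => val (e i) end : XG),
  (fun j x => match j with inl _ => pi x | inr i => phi i (ipart split x) end).
split=> [[[]|i] x y|[[]|i] x b|x].
- exact: rmorphD.
- by rewrite ipartD phiD.
- by rewrite /= /res_ract rmorphM /= (pi_sigma split).
- by rewrite ipart_ract phiM.
rewrite big_sumType /= (big_pred1 tt) => [|[] //].
rewrite -[LHS](subrKC (sigma (pi x))); congr (_ + _).
  by rewrite /ract /= /res_ract mul1r.
rewrite -[LHS]/(val (ipart split x)) {1}[ipart split x]phiE raddf_sum.
exact: eq_bigr.
Qed.

End DualBases.

(** * The equivalence between the two categories of filtered modules *)

Section FiltChangeOfRings.
Variables (R : comNzRingType) (Gam Lam : algType R) (I : ideal2 Gam).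
Variables (pi : {lrmorphism Gam -> Lam}) (sigma : {lrmorphism Lam -> Gam}).
Hypothesis split : split_by_nilpotent I pi sigma.

Local Notation F := (functorF pi).
Local Notation G := (functorG sigma).
Local Notation XI := (ideal_bimod sigma I).

Hypothesis G_exact : forall (K M N : lmodType Lam) (a : {linear K -> M})
  (b : {linear M -> N}), short_exact a b -> short_exact (fmap G a) (fmap G b).
Hypothesis XI_exact : forall (K M N : lmodType Lam) (a : {linear K -> M})
  (b : {linear M -> N}), short_exact a b -> short_exact (tfun_map XI a) (tfun_map XI b).

Variables (J : Type) (Theta : J -> lmodType Lam).
Hypothesis Theta_fg : forall j, fin_gen (Theta j).
Hypothesis homI : forall j k, Hom_zero (Theta j) (tensor XI (Theta k)).
Hypothesis extI : forall j k, lifts (Theta j) (tensor XI (Theta k)).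

Let GTheta j := G (Theta j).
Let FiltTheta := Filt (fun _ => True) Theta.
Let FiltGTheta := Filt (fun _ => True) GTheta.

Lemma Filt_G (P : J -> Prop) (M : lmodType Lam) : Filt P Theta M -> Filt P GTheta (G M).
Proof.
apply: (Filt_ind (T := fun M => Filt P GTheta (G M))) => {M} [M N MN|M M0|K M j f g Pj ex].
- exact/Filt_iso/tfun_iso.
- exact/Filt_zero/tens_zero.
- exact: (Filt_ext (X := GTheta) (fin_gen_G sigma (Theta_fg j)) Pj (G_exact ex)).
Qed.

Lemma Hom_zero_tensor (M M' : lmodType Lam) :
  FiltTheta M -> FiltTheta M' -> Hom_zero M (tensor XI M').
Proof.
move=> filM filM'; apply: (Hom_zero_Filt _ filM) => j _.
move: M' filM'; apply: (Filt_ind (T := fun M' => Hom_zero (Theta j) (tensor XI M'))).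
- move=> M1 M2 /iso_mod_sym/(tfun_iso XI)[u /bij_inj u_inj].
  exact: Hom_zero_sub u_inj.
- by move=> M0 M00 f x; exact: (tens_zero M00).
- by move=> K M' k f g _ ex hK; exact: Hom_zero_ext_r (XI_exact ex) hK (@homI j k).
Qed.

Lemma lifts_tensor j (M' : lmodType Lam) :
  FiltTheta M' -> lifts (Theta j) (tensor XI M').
Proof.
apply: (Filt_ind (T := fun M' => lifts (Theta j) (tensor XI M'))).
- by move=> M1 M2 /(tfun_iso XI); exact: lifts_iso_r.
- by move=> M0 M00; exact/lifts_zero/tens_zero.
- by move=> K M k f g _ ex lK; exact: lifts_ext (XI_exact ex) lK (@extI j k).
Qed.

(** Induction on the filtration: the kernel is some [G M'] up to isomorphism and the top factor is
    [G (Theta j)], so [G_extension] describes the middle term. *)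
Lemma G_dense (N : lmodType Gam) : FiltGTheta N ->
  exists2 M, FiltTheta M & iso_mod (G M) N.
Proof.
apply: (Filt_ind (T := fun N => exists2 M, FiltTheta M & iso_mod (G M) N)).
- by move=> N1 N2 N12 [M filM GMN]; exists M => //; exact: iso_mod_trans N12.
- move=> N1 N0; have FN0 : zero_mod (F N1) by exact: tens_zero.
  exists (F N1); first exact: Filt_zero.
  have GZ0 : zero_mod (G (F N1)) by exact: tens_zero.
  exists \0; apply: bijective_inj_surj => [x y _|z]; first by rewrite (GZ0 x) (GZ0 y).
  by exists 0; rewrite (N0 z).
- move=> K E j f g _ ex [M' filM' [u u_bij]].
  have [E0 [a [b [ab GE0]]]] :=
    G_extension split G_exact (short_exact_isol u_bij ex) (@lifts_tensor j _ filM').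
  by exists E0 => //; exact: Filt_ext (Theta_fg j) _ ab filM'.
Qed.

Lemma Filt_F (N : lmodType Gam) : FiltGTheta N -> FiltTheta (F N).
Proof.
move=> /G_dense[M filM GMN]; apply: Filt_iso filM.
apply: iso_mod_trans (tfun_iso _ GMN).
by apply: iso_mod_sym; exists (counitFG split M); exact: counitFG_bij.
Qed.

(* There is no natural map [G (F N) -> N] on all modules: transport the counit of
   [F G] along a chosen isomorphism [G M -> N]; naturality is then the fullness
   of [G]. *)
Lemma unitGF_iso_id : comp_iso_id FiltGTheta F G.
Proof.
have dataP N : FiltGTheta N -> exists e : {linear G (F N) -> N},
    exists (M : lmodType Lam) (u : {linear G M -> N}) (v : {linear N -> G M}),
    [/\ FiltTheta M, cancel u v, cancel v u
      & forall x, e x = u (fmap G (counitFG split M) (fmap G (fmap F v) x))].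
  move=> /G_dense[M filM [u /bij_inv[v [uK vK]]]].
  exists (u \o (fmap G (counitFG split M) \o fmap G (fmap F v) : {linear _ -> _})).
  by exists M, u, v.
exists (fun N filN => sval (cid (dataP N filN))); split=> [N filN|N N' filN filN' f x].
  have [M [u [v [_ uK vK eE]]]] := svalP (cid (dataP N filN)).
  apply: (eq_bij (f := u \o (fmap G (counitFG split M) \o fmap G (fmap F v)))).
    apply: bij_comp; first by exists v.
    apply: bij_comp.
      have [w [cK wK]] := bij_inv (counitFG_bij split M).
      by exists (fmap G w); exact: tfun_cancel.
    by exists (fmap G (fmap F u)); do 2!apply: tfun_cancel.
  by move=> x; rewrite eE.
have [M [u [v [filM uK vK eE]]]] := svalP (cid (dataP N filN)).
have [M' [u' [v' [filM' uK' vK' eE']]]] := svalP (cid (dataP N' filN')).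
rewrite eE eE'.
(* Conjugated to a map [G M -> G M'], [f] is [fmap G h]; the naturality square then reduces to that
   of [counitFG] at [h]. *)
have [h hE] := G_full split (v' \o (f \o u : {linear _ -> _}) : {linear _ -> _})
  (Hom_zero_tensor filM filM').
have v'f y : v' (f y) = fmap G h (v y) by rewrite -hE /= vK.
have fu y : f (u y) = u' (fmap G h y) by rewrite -hE /= vK'.
rewrite fu; congr (u' _).
have Gc := @fmap_comp _ _ G; have Fc := @fmap_comp _ _ F.
transitivity (fmap G (counitFG split M')
  (fmap G (fmap F (fmap G h)) (fmap G (fmap F v) x))).
  congr (fmap G (counitFG split M') _).
  rewrite -[LHS]/((_ \o _) x) -[RHS]/((_ \o _) x) -!Gc; apply: fmap_ext => y.
  rewrite -[LHS]/((_ \o _) y) -[RHS]/((_ \o _) y) -!Fc; apply: fmap_ext => z.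
  exact: v'f.
move: (fmap G (fmap F v) x) => y.
rewrite -[LHS]/((_ \o _) y) -[RHS]/((_ \o _) y) -!Gc; apply: fmap_ext => z.
exact: counitFG_natural.
Qed.

End FiltChangeOfRings.

Theorem theorem5p15
  (R : comNzRingType) (Gam Lam : algType R)
  (artinGam : artin_algebra Gam) (artinLam : artin_algebra Lam)
  (I : ideal2 Gam)
  (pi : {lrmorphism Gam -> Lam}) (sigma : {lrmorphism Lam -> Gam})
  (split : split_by_nilpotent I pi sigma)
  (I_proj : projective (rmod (ideal_bimod sigma I)))
  (t : nat) (Theta Q : 'I_t -> lmodType Lam) (le : rel 'I_t)
  (epss : ext_projective_system Theta Q le)
  (hom0 : Hom_zero (dirsum Theta) (tensor (ideal_bimod sigma I) (dirsum Theta)))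
  (ext0 : Ext1_zero (dirsum Q) (tensor (ideal_bimod sigma I) (dirsum Theta))) :
  let F := functorF pi in
  let G := functorG sigma in
  let GTheta := fun i => G (Theta i) in
  let GQ := fun i => G (Q i) in
  let FiltTheta := Filt (fun _ => True) Theta in
  let FiltGTheta := Filt (fun _ => True) GTheta in
  (stratifying_system Theta le /\
   compatible (ideal_bimod sigma I) Theta le /\
   associated_ext_projective_system GTheta GQ le) /\
  (exact_on FiltTheta G /\
   equivalence_with_quasi_inverse FiltTheta FiltGTheta G F).
Proof.
move=> F G GTheta GQ FiltTheta FiltGTheta.
have [artR Gam_fg] := artinGam; have [_ Lam_fg] := artinLam.
pose XI := ideal_bimod sigma I.
have [n [e [phi XI_basis]]] := ideal_dual_basis split Gam_fg I_proj.
have [J [e' [phi' XG_basis]]] := ring_dual_basis split XI_basis.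
have XI_exact (K M N : lmodType Lam) (a : {linear K -> M}) (b : {linear M -> N}) :
  short_exact a b -> short_exact (tfun_map XI a) (tfun_map XI b).
  exact: (tens_map_exact XI_basis).
have G_exact (K M N : lmodType Lam) (a : {linear K -> M}) (b : {linear M -> N}) :
  short_exact a b -> short_exact (fmap G a) (fmap G b).
  exact: (tens_map_exact XG_basis).
have [le_lin Theta_fg Q_fg Theta_hom0 [resol /Ext1_zero_lifts QTheta]] := epss.
have fgTheta i : fin_gen (Theta i) by case: (Theta_fg i).
have inXI i : injective (tfun_map XI (ds_in Theta i)).
  by apply: can_inj; apply: tfun_cancel; exact: ds_inK.
have homI i j : Hom_zero (Theta i) (tensor XI (Theta j)).
  apply: (Hom_zero_sub (@inXI j)).
  by apply: Hom_zero_retract_l hom0; exact: ds_inK.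
move/Ext1_zero_lifts: ext0 => ext0.
have extQ i j : lifts (Q i) (tensor XI (Theta j)).
  apply: (@lifts_retract_l _ _ _ _ (ds_in Q i) (ds_out Q i)); first exact: ds_inK.
  by apply: lifts_retract_r ext0; apply: tfun_cancel; exact: ds_inK.
(* [homI] extends along the filtration of K(i), which lets [lifts_quot] descend from [Q i] to
   [Theta i]. *)
have extI i j : lifts (Theta i) (tensor XI (Theta j)).
  have [K [f [g [filK ex]]]] := resol i.
  by apply: (lifts_quot ex) (extQ i j); apply: Hom_zero_Filt filK => k _.
have epssG : ext_projective_system GTheta GQ le.
  split=> // [i|i|i j ji|].
  - split; first exact: fin_gen_G.
    have [_ Theta_nz] := Theta_fg i; move=> GTheta0; apply: Theta_nz => x.
    by rewrite -[x](unitGK split) (GTheta0 (unitG sigma _ x)) linear0.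
  - have [fgQ Q_indec] := Q_fg i.
    by split; [exact: fin_gen_G | exact: (indecomposable_G split fgQ Q_indec)].
  - exact: (Hom_zero_G split (Theta_hom0 i j ji) (homI i j)).
  split=> [i|].
    have [K [f [g [filK ex]]]] := resol i.
    exists (G K), (fmap G f), (fmap G g); split; last exact: G_exact.
    exact: (Filt_G G_exact fgTheta filK).
  apply: lifts_Ext1_zero.
  (* The sums of the [GQ i] and of the [GTheta i] are retracts of [G] applied to the sums, where
     [lifts_GG] uses both Ext hypotheses directly. *)
  have [s [r rs]] := tens_dirsum_retract
    (ring_bimod (idfun : {rmorphism Gam -> Gam}) sigma) Q.
  have [s' [r' rs']] := tens_dirsum_retract
    (ring_bimod (idfun : {rmorphism Gam -> Gam}) sigma) Theta.
  apply: (lifts_retract_l rs); apply: (lifts_retract_r rs').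
  exact: (lifts_GG split QTheta ext0).
split; last first.
  split=> [K M N f g _ _ _|]; first exact: G_exact.
  split.
  - by move=> M; exact: (Filt_G G_exact fgTheta).
  - by move=> N; exact: (Filt_F split G_exact XI_exact fgTheta extI).
  - exact: (counitFG_iso_id split).
  - exact: (unitGF_iso_id split G_exact XI_exact fgTheta homI extI).
split; first exact: (epss_stratifying epss artR (fin_gen_in_alg Lam_fg)).
split; last by split=> //; exact: (epss_stratifying epssG artR (fin_gen_in_alg Gam_fg)).
by split=> i j _; [exact: homI | exact/lifts_Ext1_zero].
Qed.
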